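(* Let $f\in \mathrm{Hol}(\mathbb B_n)$ and let $\alpha\in\mathbb R$ be fixed. Let $q\in\mathbb N$ and $\upsilon\in\mathbb R$ be such that $\alpha=2q+\upsilon$. Then $$f\in D_\alpha(\mathbb B_n)\quad\text{if and only if}\quad n^q f+R^q(f)+q\sum_{i=1}^{q-1}n^iR^{q-i}(f)\in D_{\upsilon}(\mathbb B_n).$$
   Context: $\mathbb B_n=\{z\in\mathbb C^n:\|z\|<1\}$ is the Euclidean unit ball and $\mathrm{Hol}(\mathbb B_n)$ is the class of holomorphic functions on it; each such $f$ has a unique power series $f(z)=\sum_{k}a_kz^k$ over multi-indices $k=(k_1,\dots,k_n)$ of non-negative integers, with $|k|=k_1+\dots+k_n$, $k!=k_1!\cdots k_n!$, $z^k=z_1^{k_1}\cdots z_n^{k_n}$. For $\alpha\in\mathbb R$, the Dirichlet-type space $D_\alpha(\mathbb B_n)$ consists of all $f\in\mathrm{Hol}(\mathbb B_n)$ with $$\|f\|_\alpha^2:=\sum_{k}(n+|k|)^\alpha\frac{(n-1)!\,k!}{(n-1+|k|)!}|a_k|^2<\infty .$$ $R(f)(z)=z_1\partial_{z_1}f(z)+\dots+z_n\partial_{z_n}f(z)$ is the radial derivative, and $R^q$ denotes the $q$-fold iterate of the operator $R$. *)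

(* Defs.v *)
From HB Require Import structures.
From mathcomp Require Import all_boot all_order all_algebra.
From mathcomp Require Import finmap.
From mathcomp Require Import all_classical all_reals all_analysis.
From mathcomp.real_closed Require Import complex.

Set Implicit Arguments.
Unset Strict Implicit.
Unset Printing Implicit Defensive.

Import Order.TTheory GRing.Theory Num.Theory.
Import numFieldNormedType.Exports.
Import ComplexField.Normc.

Local Open Scope classical_set_scope.
Local Open Scope complex_scope.
Local Open Scope ring_scope.

HB.instance Definition _ (R : rcfType) := NormedModule.copy R[i] R[i]^o.

Section DirichletType.
Variables (R : realType) (n : nat).

Definition euclid_norm (z : 'rV[R[i]]_n) : R :=
  Num.sqrt (\sum_(i < n) normc (z ord0 i) ^+ 2).

Definition unit_ball : set 'rV[R[i]]_n := [set z | euclid_norm z < 1].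

(* Functions on the ball are represented by total functions on C^n, whose
   values outside the ball are never used.  Differentiability is over the field
   R[i], hence complex; the sup-norm topology of 'rV[R[i]]_n is the Euclidean
   one, for which the ball is open. *)
Definition Hol (f : 'rV[R[i]]_n -> R[i]) : Prop :=
  forall z, unit_ball z -> differentiable f z.

(* The derivative of f in the direction of the i-th basis vector, with
   increments in R[i], is the complex partial derivative. *)
Definition radial (f : 'rV[R[i]]_n -> R[i]) : 'rV[R[i]]_n -> R[i] :=
  fun z => \sum_(i < n) z ord0 i * 'D_(delta_mx ord0 i) f z.

Definition multi_index := {ffun 'I_n -> nat}.

Definition mi_deg (k : multi_index) : nat := (\sum_(i < n) k i)%N.

Definition mi_fact (k : multi_index) : nat := (\prod_(i < n) (k i)`!)%N.

Definition monomial (z : 'rV[R[i]]_n) (k : multi_index) : R[i] :=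
  \prod_(i < n) z ord0 i ^+ k i.

(* Convergence along the net of finite sets of multi-indices, that is
   unconditional, equivalently absolute, convergence. *)
Definition has_sum (u : multi_index -> R[i]) (s : R[i]) : Prop :=
  forall e : R, 0 < e -> exists A : {fset multi_index},
    forall B : {fset multi_index}, (A `<=` B)%fset ->
      normc (s - \sum_(k <- B) u k) < e.

Definition is_power_series (f : 'rV[R[i]]_n -> R[i])
    (a : multi_index -> R[i]) : Prop :=
  forall z, unit_ball z -> has_sum (fun k => a k * monomial z k) (f z).

Definition dirichlet_sqnorm (alpha : R) (a : multi_index -> R[i]) : \bar R :=
  \esum_(k in [set: multi_index])
    ((n + mi_deg k)%:R `^ alpha
     * ((n.-1)`!%:R * (mi_fact k)%:R / ((n.-1 + mi_deg k)`!)%:R)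
     * normc (a k) ^+ 2)%:E.

(* The power series of a holomorphic function on the ball exists and is unique,
   so quantifying existentially over its coefficients is unambiguous. *)
Definition Dirichlet (alpha : R) (f : 'rV[R[i]]_n -> R[i]) : Prop :=
  Hol f /\ exists2 a : multi_index -> R[i],
    is_power_series f a & (dirichlet_sqnorm alpha a < +oo)%E.

End DirichletType.

(* Main.v *)
Require Import Defs.
From mathcomp Require Import all_boot all_order all_algebra.
From mathcomp Require Import finmap.
From mathcomp Require Import all_classical all_reals all_analysis.
From mathcomp.real_closed Require Import complex.
From mathcomp Require Import ring lra.

Set Implicit Arguments.
Unset Strict Implicit.
Unset Printing Implicit Defensive.

Import Order.TTheory GRing.Theory Num.Theory.
Import numFieldNormedType.Exports.
Import ComplexField.Normc.

Local Open Scope classical_set_scope.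
Local Open Scope complex_scope.
Local Open Scope ring_scope.

(** The radial derivative multiplies a homogeneous polynomial of degree m by m.
    Hence the operator of the theorem multiplies the coefficient a_k of a power
    series by symbol(|k|), where
      symbol(m) = n^q + m^q + q (n m^(q-1) + ... + n^(q-1) m).
    Since n >= 1, symbol(m) lies between two positive multiples of (n + m)^q
    (symbol_le, symbol_ge).  So (n + |k|)^upsilon |symbol(|k|) a_k|^2 and
    (n + |k|)^(2q + upsilon) |a_k|^2 are comparable, and one norm is finite
    exactly when the other is (dirichlet_sqnorm_le).

    What remains is to justify this calculus for a function that is only assumed
    to be complex differentiable in the ball.  Everything is read off on the
    slices y |-> f(y z).  There a holomorphic function is the sum of its Taylor
    series (cauchy_expansion), and the radial derivative multiplies the m-th
    Taylor coefficient by m (iter_radial_expansion).  If f has a power series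
    with coefficients a_k, the m-th Taylor coefficient on the slice is the sum of
    the terms of degree m, by uniqueness of Taylor coefficients; so the function
    g produced by the operator has the power series symbol(|k|) a_k.
    Conversely, if g has a power series with coefficients b_k, the same
    uniqueness shows that the Taylor coefficients of f on the slices are the
    homogeneous parts of the family b_k / symbol(|k|), whose series therefore
    converges to f.  In this way the expansion of f comes from that of g, and
    Cauchy's theory in one variable is enough.  Passing from slices to
    unconditional sums over multi-indices is power_series_multiplier; absolute
    convergence at a slightly larger point absorbs the polynomial growth of the
    symbol.

    Two facts carry the analysis.  The first is Cauchy's formula on a circle
    without continuity of the derivative.  The closed form phi(w) dw / (w - a) is
    pulled back to a rectangle by homotheties centred at a, and Goursat's
    bisection (mixed_difference_eq0) shows that its integral over the image
    circle does not depend on the ratio; letting the ratio tend to 0 gives the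
    formula (turn_integral_cauchy).  The second is that the radial derivative of
    a holomorphic function is again holomorphic (Hol_radial), without which its
    iterates would be meaningless.  It follows from Cauchy's estimates on the
    slices: the first order Taylor formula has a uniform quadratic error, and
    Cauchy's estimate along an axis transfers this to the partial derivatives
    (partial_differentiable). *)

(** * Complex modulus and differentiable curves *)

Section ComplexNorm.
Variable R : realType.
Implicit Types (x y z : R[i]) (a b : R).

Lemma normc_ge0 x : 0 <= normc x.
Proof. by case: x => a b /=; rewrite sqrtr_ge0. Qed.

Lemma normc_norm x : `|x| = (normc x)%:C.
Proof. by case: x. Qed.

Lemma normc_real a : normc a%:C = `|a|.
Proof. by rewrite /= expr0n addr0 sqrtr_sqr. Qed.

Lemma normc_0 : normc (0 : R[i]) = 0.
Proof. exact: normc0. Qed.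

Lemma normc_1 : normc (1 : R[i]) = 1.
Proof. exact: normc1. Qed.

Lemma normcX x n : normc (x ^+ n) = normc x ^+ n.
Proof.
by elim: n => [|n IH]; rewrite ?expr0 ?normc_1// !exprS normcM IH.
Qed.

Lemma normc_nat n : normc (n%:R : R[i]) = n%:R.
Proof. by rewrite (normcMn 1) normc_1. Qed.

Lemma normc_eq0 x : (normc x == 0) = (x == 0).
Proof.
by apply/eqP/eqP => [/eq0_normc//|->]; rewrite normc_0.
Qed.

Lemma normc_gt0 x : (0 < normc x) = (x != 0).
Proof. by rewrite lt_neqAle normc_ge0 eq_sym normc_eq0 andbT. Qed.

Lemma le_normcB x y : normc (x - y) <= normc x + normc y.
Proof. by rewrite (le_trans (le_normcD _ _))// normcN. Qed.

Lemma normc_distC x y : normc (x - y) = normc (y - x).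
Proof. by rewrite -normcN opprB. Qed.

Lemma normc_triangle x y z : normc (x - z) <= normc (x - y) + normc (y - z).
Proof.
have -> : x - z = (x - y) + (y - z) by ring.
exact: le_normcD.
Qed.

Lemma normc_sum (I : Type) (r : seq I) (P : pred I) (F : I -> R[i]) :
  normc (\sum_(i <- r | P i) F i) <= \sum_(i <- r | P i) normc (F i).
Proof.
elim/big_ind2 : _ => // [|x1 x2 y1 y2 h1 h2]; first by rewrite normc_0.
by rewrite (le_trans (le_normcD _ _))// lerD.
Qed.

Lemma Re_le_normc x : `|complex.Re x| <= normc x.
Proof.
case: x => a b /=; rewrite -[leLHS]sqrtr_sqr ler_sqrt ?addr_ge0 ?sqr_ge0//.
by rewrite lerDl sqr_ge0.
Qed.

Lemma Im_le_normc x : `|complex.Im x| <= normc x.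
Proof.
case: x => a b /=; rewrite -[leLHS]sqrtr_sqr ler_sqrt ?addr_ge0 ?sqr_ge0//.
by rewrite lerDr sqr_ge0.
Qed.

Lemma normc_le_ReIm x : normc x <= `|complex.Re x| + `|complex.Im x|.
Proof.
rewrite [x in normc x]complexE (le_trans (le_normcD _ _))// normcM !normc_real.
by rewrite /= expr0n add0r expr1n sqrtr1 mul1r.
Qed.

Lemma ReD x y : complex.Re (x + y) = complex.Re x + complex.Re y.
Proof. by case: x; case: y. Qed.
Lemma ImD x y : complex.Im (x + y) = complex.Im x + complex.Im y.
Proof. by case: x; case: y. Qed.
Lemma ReN x : complex.Re (- x) = - complex.Re x.
Proof. by case: x. Qed.
Lemma ImN x : complex.Im (- x) = - complex.Im x.
Proof. by case: x. Qed.
Lemma ReM x y :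
  complex.Re (x * y) = complex.Re x * complex.Re y - complex.Im x * complex.Im y.
Proof. by case: x; case: y. Qed.
Lemma ImM x y :
  complex.Im (x * y) = complex.Re x * complex.Im y + complex.Im x * complex.Re y.
Proof. by case: x; case: y. Qed.

Lemma eqc_norm0 x y : (forall e : R, 0 < e -> normc (x - y) <= e) -> x = y.
Proof.
move=> h; apply/eqP; rewrite -subr_eq0 -normc_eq0 eq_le normc_ge0 andbT.
by apply/ler_addgt0Pr => e e0; rewrite add0r h.
Qed.

End ComplexNorm.

Section RealCurve.
Variable R : realType.
Implicit Types (F G : R -> R[i]) (u v : R[i]) (x : R).

(** Bridges the library derivative of real functions, which carries the mean
    value theorem and the fundamental theorem of calculus, and the quantitative
    form in which the chain rule with a complex differentiable function is
    proved. *)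
Lemma is_derive_epsP (f : R -> R) x (d : R) :
  is_derive x 1 f d <->
  forall e, 0 < e -> exists2 s, 0 < s &
    forall h, `|h| < s -> `|f (x + h) - f x - h * d| <= e * `|h|.
Proof.
split=> [[df <-]|H].
- move=> e e0; move/derivable_nbhsP/eqaddoP: df => /(_ e e0).
  move/nbhs_ballP => [s /= s0 Hs]; exists s => // h hs.
  have := Hs h; rewrite /ball/= sub0r normrN => /(_ hs).
  by rewrite !fctE /= /GRing.scale/= mulr1 opprD addrA [h + x]addrC.
- have cv : (fun h : R => h^-1 *: (f (h *: 1 + x) - f x)) @ 0^' --> d.
    apply/cvgrPdist_le => e e0; have [s s0 Hs] := H e e0.
    exists s => // h /=; rewrite sub0r normrN => hs h0.
    have h0' : 0 < `|h| by rewrite normr_gt0.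
    rewrite -(ler_pM2r h0') (le_trans _ (Hs h hs))// -normrM -normrN.
    rewrite /GRing.scale/= mulr1 [h + x]addrC.
    by rewrite le_eqVlt; apply/orP; left; apply/eqP; congr (`|_|); field.
  by apply: DeriveDef; [apply/cvg_ex; exists d | exact: cvg_lim].
Qed.

(** A curve in the complex plane is differentiated componentwise, so that the
    mean value theorem and the fundamental theorem of calculus for real
    functions apply. *)
Definition cderive (G : R -> R[i]) (x : R) (v : R[i]) : Prop :=
  is_derive x 1 (fun t => complex.Re (G t)) (complex.Re v) /\
  is_derive x 1 (fun t => complex.Im (G t)) (complex.Im v).

Lemma cderive_eq G x u v : cderive G x u -> u = v -> cderive G x v.
Proof. by move=> ? <-. Qed.

Lemma cderive_epsP G x v : cderive G x v <->
  forall e : R, 0 < e -> exists2 s : R, 0 < s &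
    forall h : R, `|h| < s -> normc (G (x + h) - G x - h%:C * v) <= e * `|h|.
Proof.
have E h : complex.Re (G (x + h) - G x - h%:C * v) =
   complex.Re (G (x + h)) - complex.Re (G x) - h * complex.Re v.
  by rewrite !ReD !ReN ReM /= mul0r subr0.
have F h : complex.Im (G (x + h) - G x - h%:C * v) =
   complex.Im (G (x + h)) - complex.Im (G x) - h * complex.Im v.
  by rewrite !ImD !ImN ImM /= mul0r addr0.
split=> [[/is_derive_epsP HR /is_derive_epsP HI] e e0|H].
  have e20 : 0 < e / 2 by rewrite divr_gt0.
  have [s s0 Hs] := HR _ e20; have [t t0 Ht] := HI _ e20.
  exists (Num.min s t); first by rewrite lt_min s0.
  move=> h; rewrite lt_min => /andP[hs ht].
  rewrite (le_trans (normc_le_ReIm _))// E F (splitr e) mulrDl.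
  by rewrite lerD ?Hs ?Ht.
split; apply/is_derive_epsP => e e0; have [s s0 Hs] := H _ e0;
  exists s => // h /Hs; apply: le_trans.
- by rewrite -E Re_le_normc.
- by rewrite -F Im_le_normc.
Qed.

Lemma cderive_cst u x : cderive (fun=> u) x 0.
Proof. by split; exact: is_derive_cst. Qed.

Lemma cderive_real x : cderive (fun t => t%:C) x 1.
Proof. by split => /=; [exact: is_derive_id | exact: is_derive_cst]. Qed.

Lemma cderiveD F G x u v :
  cderive F x u -> cderive G x v -> cderive (fun t => F t + G t) x (u + v).
Proof.
move=> [F1 F2] [G1 G2]; split.
  under eq_fun do rewrite ReD.
  by apply: is_derive_eq; rewrite ReD.
under eq_fun do rewrite ImD.
by apply: is_derive_eq; rewrite ImD.
Qed.

Lemma cderiveN F x u : cderive F x u -> cderive (fun t => - F t) x (- u).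
Proof.
move=> [F1 F2]; split.
  under eq_fun do rewrite ReN.
  by apply: is_derive_eq; rewrite ReN.
under eq_fun do rewrite ImN.
by apply: is_derive_eq; rewrite ImN.
Qed.

Lemma cderiveB F G x u v :
  cderive F x u -> cderive G x v -> cderive (fun t => F t - G t) x (u - v).
Proof. by move=> HF HG; apply: cderiveD => //; exact: cderiveN. Qed.

Lemma cderiveM F G x u v : cderive F x u -> cderive G x v ->
  cderive (fun t => F t * G t) x (u * G x + F x * v).
Proof.
move=> [F1 F2] [G1 G2]; split.
  under eq_fun do rewrite ReM.
  by apply: is_derive_eq; rewrite ReD !ReM /GRing.scale/=; ring.
under eq_fun do rewrite ImM.
by apply: is_derive_eq; rewrite ImD !ImM /GRing.scale/=; ring.
Qed.

Lemma cderiveMl F x c u :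
  cderive F x u -> cderive (fun t => c * F t) x (c * u).
Proof.
move=> HF; apply: cderive_eq; first exact: (cderiveM (cderive_cst c x) HF).
by rewrite mul0r add0r.
Qed.

(** Comparing the two components with the mean value theorem costs a factor 2
    over the sharp bound. *)
Lemma cderive_mvt F (F' : R -> R[i]) (a b M : R) : a <= b ->
  (forall x, a <= x <= b -> cderive F x (F' x)) ->
  (forall x, a <= x <= b -> normc (F' x) <= M) ->
  normc (F b - F a) <= 2 * M * (b - a).
Proof.
move=> ab dF bF.
have aux (p q : R -> R) :
    (forall x, a <= x <= b -> is_derive x 1 p (q x)) ->
    (forall x, a <= x <= b -> `|q x| <= M) -> `|p b - p a| <= M * (b - a).
  move=> dp bq.
  have [||c] := @MVT_segment _ p q a b ab.
  - move=> x; rewrite in_itv/= => /andP[ax xb].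
    by apply: dp; rewrite !ltW.
  - apply: derivable_within_continuous => x; rewrite in_itv/= => xab.
    by have [] := dp _ xab.
  - rewrite in_itv/= => cab ->; rewrite normrM (ger0_norm (_ : 0 <= b - a)) ?subr_ge0//.
    by rewrite ler_wpM2r ?subr_ge0// bq.
rewrite (le_trans (normc_le_ReIm _))// -mulrA mulr_natl mulr2n lerD//.
  rewrite ReD ReN; apply: (aux (fun x => complex.Re (F x)) (fun x => complex.Re (F' x))).
    by move=> x /dF[].
  by move=> x /bF; apply: le_trans; exact: Re_le_normc.
rewrite ImD ImN; apply: (aux (fun x => complex.Im (F x)) (fun x => complex.Im (F' x))).
  by move=> x /dF[].
by move=> x /bF; apply: le_trans; exact: Im_le_normc.
Qed.

Lemma cderive0_const F (a b : R) : a <= b ->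
  (forall x, a <= x <= b -> cderive F x 0) -> F b = F a.
Proof.
move=> ab dF; apply: eqc_norm0 => e e0.
apply: (le_trans (@cderive_mvt F (fun=> 0) a b 0 ab dF _)).
  by move=> x _; rewrite normc_0.
by rewrite mulr0 mul0r ltW.
Qed.

Definition ccont (G : R -> R[i]) (x : R) : Prop :=
  {for x, continuous (fun t => complex.Re (G t))} /\
  {for x, continuous (fun t => complex.Im (G t))}.

Lemma ccont_epsP G x : ccont G x <->
  forall e : R, 0 < e -> exists2 s : R, 0 < s &
    forall t : R, `|t - x| < s -> normc (G t - G x) <= e.
Proof.
split=> [[HR HI] e e0|H].
  have e20 : 0 < e / 2 by rewrite divr_gt0.
  move/cvgrPdist_le: HR => /(_ _ e20) /nbhs_ballP[s /= s0 Hs].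
  move/cvgrPdist_le: HI => /(_ _ e20) /nbhs_ballP[t /= t0 Ht].
  exists (Num.min s t); first by rewrite lt_min s0.
  move=> h; rewrite lt_min => /andP[hs ht].
  rewrite (le_trans (normc_le_ReIm _))// (splitr e) lerD//.
    by rewrite ReD ReN distrC; apply: Hs; rewrite -ball_normE/= distrC.
  by rewrite ImD ImN distrC; apply: Ht; rewrite -ball_normE/= distrC.
split; apply/cvgrPdist_le => e e0; have [s s0 Hs] := H e e0;
  exists s => // t /=; rewrite distrC => ts;
  apply: le_trans (Hs _ ts); rewrite normc_distC.
- by rewrite -ReN -ReD Re_le_normc.
- by rewrite -ImN -ImD Im_le_normc.
Qed.

Lemma cderive_ccont F x u : cderive F x u -> ccont F x.
Proof.
move=> [[d1 _] [d2 _]]; split.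
  exact: differentiable_continuous ((derivable1_diffP _ _).1 d1).
exact: differentiable_continuous ((derivable1_diffP _ _).1 d2).
Qed.

Lemma continuous_at_ext (f g : R -> R) x :
  f =1 g -> {for x, continuous f} -> {for x, continuous g}.
Proof. by move=> /funext ->. Qed.

Lemma ccontM F G x : ccont F x -> ccont G x -> ccont (fun t => F t * G t) x.
Proof.
move=> [F1 F2] [G1 G2]; split.
  by apply: (continuous_at_ext (fun t => esym (ReM _ _))); apply: cvgB; apply: cvgM.
by apply: (continuous_at_ext (fun t => esym (ImM _ _))); apply: cvgD; apply: cvgM.
Qed.

Lemma ccontD F G x : ccont F x -> ccont G x -> ccont (fun t => F t + G t) x.
Proof.
move=> [F1 F2] [G1 G2]; split.
  by apply: (continuous_at_ext (fun t => esym (ReD _ _))); apply: cvgD.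
by apply: (continuous_at_ext (fun t => esym (ImD _ _))); apply: cvgD.
Qed.

Lemma real_antiderivative (f : R -> R) (a b : R) : a < b ->
  {within `[a, b], continuous f} ->
  exists g : R -> R, forall x, a < x < b -> {for x, continuous f} ->
    is_derive x 1 g (f x).
Proof.
move=> ab cf.
exists (fun x => \int[lebesgue_measure]_(t in `[a, x]) f t) => x /andP[ax xb] cx.
have [|d] := continuous_FTC1_closed xb _ ax cx.
  exact: continuous_compact_integrable (@segment_compact _ a b) cf.
by move=> e; apply: (DeriveDef d); rewrite -derive1E e.
Qed.

Lemma cderive_antiderivative F (a b : R) : a < b ->
  (forall x, a <= x <= b -> ccont F x) ->
  exists G : R -> R[i], forall x, a < x < b -> cderive G x (F x).
Proof.
move=> ab cF.
have W (f : R -> R) : (forall x, a <= x <= b -> {for x, continuous f}) ->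
    {within `[a, b], continuous f}.
  by move=> H; apply: continuous_in_subspaceT => x;
    rewrite inE/= in_itv/= => /H.
have [g Hg] := real_antiderivative ab (W _ (fun x xab => (cF x xab).1)).
have [k Hk] := real_antiderivative ab (W _ (fun x xab => (cF x xab).2)).
exists (fun x => g x +i* k x) => x xab.
have xab' : a <= x <= b by case/andP: xab => *; rewrite !ltW.
by have [c1 c2] := cF x xab'; split => /=; [exact: Hg|exact: Hk].
Qed.

End RealCurve.

(** * Goursat's bisection *)

Section Goursat.
Variable R : realType.

Definition mixed_difference (W : R -> R -> R[i]) (x x' y y' : R) : R[i] :=
  W x' y' - W x' y - W x y' + W x y.

(** Increments dominated by a geometric series; stated as nested intervals since
    this is how both coordinates of the bisected rectangles behave. *)
Lemma nested_intervals (u : nat -> R) (A : R) : 0 <= A ->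
  (forall n, u n <= u n.+1 <= u n + A / 2 ^+ n.+1) ->
  exists x, forall n, u n <= x <= u n + A / 2 ^+ n.
Proof.
move=> A0 hu.
have nd : {homo u : n m / (n <= m)%N >-> n <= m}.
  by apply: homo_leq => [//||n]; [exact: le_trans | have /andP[] := hu n].
have ni : {homo (fun n => u n + A / 2 ^+ n) : n m / (n <= m)%N >-> m <= n}.
  apply: (@homo_leq _ _ (fun x y => y <= x)) => [//|y x z h1 h2|n].
    exact: le_trans h2 h1.
  have /andP[_ h] := hu n; rewrite (le_trans (lerD h (lexx _)))//.
  rewrite -addrA lerD2l exprS invfM; lra.
have ub n m : u n <= u m + A / 2 ^+ m.
  have p k : 0 <= A / 2 ^+ k by rewrite divr_ge0// exprn_ge0.
  case: (leqP n m) => [/nd h|/ltnW/ni h].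
    by rewrite (le_trans h)// lerDl.
  by rewrite (le_trans _ h)// lerDl.
have ne : range u !=set0 by exists (u 0%N), 0%N.
exists (sup (range u)) => n; apply/andP; split.
  apply: ub_le_sup; last by exists n.
  by exists (u 0%N + A / 2 ^+ 0) => _ [m _ <-].
by apply: ge_sup => // _ [m _ <-].
Qed.

(** This is the bisection at the heart of Goursat's theorem, freed from contour
    integrals.  A mixed difference is additive under cutting a rectangle, so if
    it is nonzero then one of the four quarters carries at least a quarter of
    it; iterating yields a point around which it is not infinitesimal compared
    with the area. *)
Lemma mixed_difference_eq0 (W : R -> R -> R[i]) (a b c d : R) :
  a <= b -> c <= d ->
  (forall x y, a <= x <= b -> c <= y <= d -> forall e, 0 < e ->
    exists2 s, 0 < s & forall u u' v v', a <= u -> u <= x <= u' -> u' <= b ->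
      c <= v -> v <= y <= v' -> v' <= d -> u' - u < s -> v' - v < s ->
      normc (mixed_difference W u u' v v') <= e * (u' - u + (v' - v)) ^+ 2) ->
  mixed_difference W a b c d = 0.
Proof.
move=> ab cd small.
pose A := b - a; pose B := d - c.
(* The rectangles of generation n have sides A / 2 ^ n and B / 2 ^ n and are
   recorded by their lower left corner. *)
have A0 : 0 <= A by rewrite subr_ge0.
have B0 : 0 <= B by rewrite subr_ge0.
pose Q n (p : R * R) := normc (mixed_difference W p.1 (p.1 + A / 2 ^+ n)
  p.2 (p.2 + B / 2 ^+ n)).
have step n (p : R * R) : exists q : R * R,
    [/\ p.1 <= q.1 <= p.1 + A / 2 ^+ n.+1, p.2 <= q.2 <= p.2 + B / 2 ^+ n.+1 &
        Q n p <= 4 * Q n.+1 q].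
  case: p => u v; pose A' := A / 2 ^+ n.+1; pose B' := B / 2 ^+ n.+1.
  have A'0 : 0 <= A' by rewrite divr_ge0// exprn_ge0.
  have B'0 : 0 <= B' by rewrite divr_ge0// exprn_ge0.
  have AE : A / 2 ^+ n = A' + A' by rewrite /A' exprS invfM; lra.
  have BE : B / 2 ^+ n = B' + B' by rewrite /B' exprS invfM; lra.
  apply: contrapT => none.
  have lt q1 q2 : u <= q1 <= u + A' -> v <= q2 <= v + B' ->
      Q n.+1 (q1, q2) < Q n (u, v) / 4.
    move=> h1 h2; rewrite ltNge; apply/negP => h3; apply: none.
    by exists (q1, q2); split => //=; lra.
  have l1 := lt u v; have l2 := lt (u + A') v.
  have l3 := lt u (v + B'); have l4 := lt (u + A') (v + B').
  have : Q n (u, v) <= Q n.+1 (u, v) + Q n.+1 (u + A', v)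
      + Q n.+1 (u, v + B') + Q n.+1 (u + A', v + B').
    rewrite /Q /= -/A' -/B' AE BE !addrA.
    rewrite (le_trans _ (lerD (lerD (le_normcD _ _) (lexx _)) (lexx _)))//.
    rewrite (le_trans _ (lerD (le_normcD _ _) (lexx _)))//.
    rewrite (le_trans _ (le_normcD _ _))//.
    by rewrite /mixed_difference le_eqVlt; apply/orP; left; apply/eqP; congr normc; ring.
  by rewrite leNgt => /negP; apply; lra.
(* Dependent choice of a bad quarter at every generation. *)
have /choice[next hnext] (np : nat * (R * R)) : exists q : R * R,
    [/\ np.2.1 <= q.1 <= np.2.1 + A / 2 ^+ np.1.+1,
        np.2.2 <= q.2 <= np.2.2 + B / 2 ^+ np.1.+1 &
        Q np.1 np.2 <= 4 * Q np.1.+1 q] by case: np => n p; exact: step.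
pose p := fix p n := if n is m.+1 then next (m, p m) else (a, c).
have hp n : [/\ (p n).1 <= (p n.+1).1 <= (p n).1 + A / 2 ^+ n.+1,
        (p n).2 <= (p n.+1).2 <= (p n).2 + B / 2 ^+ n.+1 &
        Q n (p n) <= 4 * Q n.+1 (p n.+1)] by exact: (hnext (n, p n)).
have Qp n : Q 0%N (p 0%N) <= 4 ^+ n * Q n (p n).
  elim: n => [|n IH]; first by rewrite expr0 mul1r.
  rewrite (le_trans IH)// exprSr -mulrA ler_wpM2l ?exprn_ge0//.
  by have [] := hp n.
have [x hx] := @nested_intervals (fun n => (p n).1) A A0 (fun n => let: And3 h _ _ := hp n in h).
have [y hy] := @nested_intervals (fun n => (p n).2) B B0 (fun n => let: And3 _ h _ := hp n in h).
have inA n : a <= (p n).1 /\ (p n).1 + A / 2 ^+ n <= b.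
  elim: n => [|n [h1 h2]] /=; first by rewrite expr0 divr1 /A; split; lra.
  have [/andP[h3 h4] _ _] := hp n; split; first exact: le_trans h3.
  rewrite (le_trans _ h2)// (le_trans (lerD h4 (lexx _)))// -addrA lerD2l exprS invfM.
  lra.
have inB n : c <= (p n).2 /\ (p n).2 + B / 2 ^+ n <= d.
  elim: n => [|n [h1 h2]] /=; first by rewrite expr0 divr1 /B; split; lra.
  have [_ /andP[h3 h4] _] := hp n; split; first exact: le_trans h3.
  rewrite (le_trans _ h2)// (le_trans (lerD h4 (lexx _)))// -addrA lerD2l exprS invfM.
  lra.
have xab : a <= x <= b.
  by have := hx 0%N; have [] := inA 0%N; rewrite /= => h1 h2 /andP[h3 h4]; rewrite h3 (le_trans h4).
have ycd : c <= y <= d.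
  by have := hy 0%N; have [] := inB 0%N; rewrite /= => h1 h2 /andP[h3 h4]; rewrite h3 (le_trans h4).
have Q0 : Q 0%N (p 0%N) = normc (mixed_difference W a b c d).
  by rewrite /Q /= expr0 !divr1 /A /B !subrKC.
apply: eqc_norm0 => e e0; rewrite subr0 -Q0.
(* At the limit point the n-th mixed difference is at most
   e * ((A + B) / 2 ^ n) ^ 2, while bisection keeps it above 4 ^ (- n) times the
   initial one. *)
pose L := A + B + 1; have L0 : 0 < L by rewrite /L; lra.
have [s s0 Hs] := small x y xab ycd (e / L ^+ 2) (divr_gt0 e0 (exprn_gt0 2 L0)).
have [n hn] : exists n : nat, L / 2 ^+ n < s.
  have [n hn] : exists n : nat, L / s < n%:R.
    by exists (Num.truncn (L / s)).+1; rewrite truncnS_gt.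
  exists n; rewrite ltr_pdivrMr ?exprn_gt0// mulrC -ltr_pdivrMr//.
  by rewrite (lt_trans hn)// -natrX ltr_nat ltn_expl.
have n20 : 0 < (2 ^+ n : R)^-1 by rewrite invr_gt0 exprn_gt0.
have [a1 a2] := inA n; have [b1 b2] := inB n.
have := Hs _ _ _ _ a1 (hx n) a2 b1 (hy n) b2.
rewrite ![_ + _ / _ - _]addrAC !subrr !add0r => /(_ _ _) bnd.
rewrite (le_trans (Qp n))//.
have {}bnd : Q n (p n) <= e / L ^+ 2 * (A / 2 ^+ n + B / 2 ^+ n) ^+ 2.
  by apply: bnd; apply: le_lt_trans hn; rewrite ler_wpM2r ?ltW// /L; lra.
rewrite (le_trans (ler_wpM2l _ bnd)) ?exprn_ge0//.
have -> : (4 : R) ^+ n = (2 ^+ n) ^+ 2.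
  by rewrite -exprM mulnC exprM; congr (_ ^+ n); ring.
have k0 : (2 ^+ n : R) != 0 by rewrite expf_neq0.
rewrite [leLHS](_ : _ = e * ((A + B) ^+ 2 / L ^+ 2)); last first.
  by move: (2 ^+ n) k0 => k k0; field; rewrite k0/= gt_eqF.
have AB0 : 0 <= A + B by rewrite addr_ge0.
rewrite ler_piMr ?(ltW e0)// ler_pdivrMr ?exprn_gt0// mul1r ler_sqr ?nnegrE ?(ltW L0) ?AB0//.
by rewrite /L; lra.
Qed.

End Goursat.

(** * Integrals over one turn of the circle *)

Section Circle.
Variable R : realType.
Implicit Types (F G : R -> R[i]) (x t : R).

Lemma tau_ge0 : 0 <= 2 * pi :> R.
Proof. by rewrite mulr_ge0// pi_ge0. Qed.

Lemma tau_gt0 : 0 < 2 * pi :> R.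
Proof. by rewrite mulr_gt0// pi_gt0. Qed.

(** The integral over [0, 2 pi] is defined through antiderivatives, so that
    linearity, estimates and integration by parts are facts on derivatives.  An
    antiderivative exists for every continuous integrand and is unique up to
    a constant, so its increment is the integral over one turn. *)
Definition is_turn_integral F (v : R[i]) : Prop :=
  exists2 G : R -> R[i], (forall t, 0 <= t <= 2 * pi -> cderive G t (F t)) &
    v = G (2 * pi) - G 0.

Definition turn_integral F : R[i] := xget 0 [set v | is_turn_integral F v].

Lemma is_turn_integral_unique F (u v : R[i]) :
  is_turn_integral F u -> is_turn_integral F v -> u = v.
Proof.
move=> [G dG ->] [H dH ->].
have : (G (2 * pi) - H (2 * pi)) = G 0 - H 0.
  apply: (cderive0_const (F := fun t => G t - H t)) tau_ge0 _ => t ht.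
  by apply: cderive_eq; [exact: cderiveB (dG t ht) (dH t ht)|rewrite subrr].
move=> /eqP; rewrite -subr_eq0 => /eqP e; apply/eqP; rewrite -subr_eq0 -e.
by apply/eqP; ring.
Qed.

Lemma turn_integralE F (v : R[i]) : is_turn_integral F v -> turn_integral F = v.
Proof.
move=> Fv; apply: is_turn_integral_unique (Fv).
by rewrite /turn_integral; case: xgetP => // /(_ v); rewrite /= => /(_ Fv).
Qed.

Lemma turn_integralP F : (forall t, ccont F t) ->
  is_turn_integral F (turn_integral F).
Proof.
move=> cF; have p0 := tau_ge0.
have [|G HG] := @cderive_antiderivative _ F (- 1) (2 * pi + 1) _ (fun x _ => cF x).
  lra.
suff h : is_turn_integral F (G (2 * pi) - G 0) by rewrite (turn_integralE h).
by exists G => // t /andP[t0 t1]; apply: HG; lra.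
Qed.

Lemma turn_integralD F G : (forall t, ccont F t) -> (forall t, ccont G t) ->
  turn_integral (fun t => F t + G t) = turn_integral F + turn_integral G.
Proof.
move=> /turn_integralP[f df ->] /turn_integralP[g dg ->].
apply: turn_integralE; exists (fun t => f t + g t); last by ring.
by move=> t ht; apply: cderiveD; auto.
Qed.

Lemma turn_integralMl (c : R[i]) F : (forall t, ccont F t) ->
  turn_integral (fun t => c * F t) = c * turn_integral F.
Proof.
move=> /turn_integralP[f df ->].
apply: turn_integralE; exists (fun t => c * f t); last by ring.
by move=> t ht; apply: cderiveMl; auto.
Qed.

Lemma turn_integral_bound F (M : R) : (forall t, ccont F t) ->
  (forall t, 0 <= t <= 2 * pi -> normc (F t) <= M) ->
  normc (turn_integral F) <= 2 * M * (2 * pi).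
Proof.
move=> /turn_integralP[f df ->] bF.
by have := cderive_mvt tau_ge0 df bF; rewrite subr0.
Qed.

Lemma ccont_cst (c : R[i]) t : ccont (fun=> c) t.
Proof. exact: cderive_ccont (cderive_cst _ _). Qed.

Lemma turn_integral_sum (c : nat -> R[i]) (F : nat -> R -> R[i]) n :
  (forall m t, ccont (F m) t) ->
  (forall t, ccont (fun t => \sum_(m < n) c m * F m t) t) /\
  turn_integral (fun t => \sum_(m < n) c m * F m t)
  = \sum_(m < n) c m * turn_integral (F m).
Proof.
move=> cF; elim: n => [|n [IH1 IH2]].
  under eq_fun do rewrite big_ord0; rewrite big_ord0; split=> [t|].
    exact: ccont_cst.
  by apply: turn_integralE; exists (fun=> 0); [move=> t _; exact: cderive_cst|rewrite subrr].
have E : (fun t => \sum_(m < n.+1) c m * F m t) =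
    (fun t => \sum_(m < n) c m * F m t + c n * F n t).
  by apply/funext => t; rewrite big_ord_recr.
have cM t : ccont (fun t => c n * F n t) t by apply: ccontM => //; exact: ccont_cst.
rewrite E big_ord_recr /= -IH2 -turn_integralMl// -turn_integralD//; split=> // t.
exact: ccontD.
Qed.

Definition ei t : R[i] := cos t +i* sin t.

Lemma cderive_ei t : cderive ei t ('i * ei t).
Proof.
split => /=; rewrite ?mul0r ?mul1r ?add0r ?addr0 ?sub0r.
  exact: is_derive_cos.
exact: is_derive_sin.
Qed.

Lemma ei_norm t : normc (ei t) = 1.
Proof. by rewrite /ei/= cos2Dsin2 sqrtr1. Qed.

Lemma ei0 : ei 0 = 1.
Proof. by rewrite /ei cos0 sin0. Qed.

Lemma ei_tau : ei (2 * pi) = 1.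
Proof. by rewrite /ei mulr_natl cos2pi sin2pi. Qed.

Lemma ei_neq0 t : ei t != 0.
Proof. by rewrite -normc_eq0 ei_norm oner_eq0. Qed.

Lemma eiN t : ei (- t) = (ei t)^-1.
Proof.
apply: (mulfI (ei_neq0 t)); rewrite mulfV ?ei_neq0// /ei cosN sinN.
apply/eqP; rewrite eq_complex/=; apply/andP; split; apply/eqP; last by ring.
by rewrite -[RHS](cos2Dsin2 t); ring.
Qed.

Lemma cderive_eiV t : cderive (fun t => (ei t)^-1) t (- 'i * (ei t)^-1).
Proof.
have E : (fun t => (ei t)^-1) = (fun t => cos t +i* (- sin t)).
  by apply/funext => s; rewrite -eiN /ei cosN sinN.
rewrite E -eiN /ei cosN sinN; split => /=.
  apply: is_derive_eq; ring.
by apply: is_derive_eq; ring.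
Qed.

Lemma cderive_eiVX m t :
  cderive (fun t => (ei t)^-1 ^+ m) t (m%:R * - 'i * (ei t)^-1 ^+ m).
Proof.
elim: m => [|m IH].
  by under eq_fun do rewrite expr0; rewrite !mul0r; exact: cderive_cst.
under eq_fun do rewrite exprS.
apply: cderive_eq; first exact: cderiveM (cderive_eiV t) IH.
by rewrite exprS -natr1; ring.
Qed.

(** Orthogonality of the characters of the circle. *)
Lemma turn_integral_eiVX m :
  turn_integral (fun t => (ei t)^-1 ^+ m) = if m == 0%N then (2 * pi)%:C else 0.
Proof.
apply: turn_integralE; case: m => [|m].
  exists (fun t => t%:C); last by rewrite rmorph0 subr0.
  by move=> t _; rewrite expr0; exact: cderive_real.
exists (fun t => ('i / m.+1%:R) * (ei t)^-1 ^+ m.+1); last first.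
  by rewrite ei_tau ei0 subrr.
move=> t _; apply: cderive_eq; first exact: cderiveMl (cderive_eiVX _ _).
have m0 : (m.+1%:R : R[i]) != 0 by rewrite pnatr_eq0.
move: (m.+1%:R) m0 => k k0.
rewrite [LHS](_ : _ = - 'i ^+ 2 * (ei t)^-1 ^+ m.+1); last by field.
by rewrite sqr_i opprK mul1r.
Qed.

End Circle.

(** * Complex differentiability *)

Section ComplexDerivative.
Variable R : realType.
Implicit Types (phi : R[i] -> R[i]) (z l : R[i]).

(** Complex differentiability at one point, in a form that does not depend on
    the norm of R[i] being valued in R[i]. *)
Definition cdiff (phi : R[i] -> R[i]) (z l : R[i]) : Prop :=
  forall e : R, 0 < e -> exists2 d : R, 0 < d &
    forall h : R[i], normc h < d -> normc (phi (z + h) - phi z - l * h) <= e * normc h.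

Definition holo_on_disc (phi : R[i] -> R[i]) (rho : R) : Prop :=
  forall z, normc z < rho -> exists l, cdiff phi z l.

Lemma cdiff_comp phi (G : R -> R[i]) x l v :
  cdiff phi (G x) l -> cderive G x v -> cderive (phi \o G) x (l * v).
Proof.
move=> dphi /cderive_epsP dG; apply/cderive_epsP => e e0.
pose K := normc v + 1; have K0 : 0 < K by rewrite /K ltr_wpDl// normc_ge0.
pose L := normc l + 1; have L0 : 0 < L by rewrite /L ltr_wpDl// normc_ge0.
have e10 : 0 < e / 2 / K by rewrite !divr_gt0.
have e20 : 0 < Num.min 1 (e / 2 / L) by rewrite lt_min ltr01 !divr_gt0.
have [d d0 Hd] := dphi _ e10; have [s s0 Hs] := dG _ e20.
exists (Num.min s (d / K)); first by rewrite lt_min s0 divr_gt0.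
move=> h; rewrite lt_min => /andP[hs hd].
have := Hs h hs; set D := G (x + h) - G x => rem.
have h0 : 0 <= `|h| by [].
have DK : normc D <= K * `|h|.
  have -> : D = (D - h%:C * v) + h%:C * v by ring.
  rewrite (le_trans (le_normcD _ _))// normcM normc_real /K mulrDl addrC.
  rewrite [normc v * _]mulrC mul1r lerD2l (le_trans rem)// ler_piMl//.
  by rewrite ge_min lexx.
have := Hd D; rewrite [G x + D]addrC subrK => /(_ _) bnd.
have {}bnd : normc (phi (G (x + h)) - phi (G x) - l * D) <= e / 2 / K * normc D.
  by apply: bnd; rewrite (le_lt_trans DK)// mulrC -ltr_pdivlMr.
rewrite /= (_ : _ - _ - _ = (phi (G (x + h)) - phi (G x) - l * D)
   + l * (D - h%:C * v)); last by ring.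
rewrite (le_trans (le_normcD _ _))// normcM (splitr e) mulrDl lerD//.
  rewrite (le_trans bnd)// (le_trans (ler_wpM2l _ DK)) ?(ltW e10)//.
  by rewrite mulrA divfK// gt_eqF.
have lL : normc l <= L by rewrite /L lerDl.
rewrite (le_trans (ler_wpM2l (normc_ge0 _) rem))//.
have mL : Num.min 1 (e / 2 / L) <= e / 2 / L by rewrite ge_min lexx orbT.
rewrite mulrA ler_wpM2r// (le_trans (ler_wpM2l (normc_ge0 _) mL))//.
rewrite mulrCA ler_piMr//; first by rewrite divr_ge0// ltW.
by rewrite ler_pdivrMr// mul1r.
Qed.

Lemma ccont_comp phi (G : R -> R[i]) x l :
  cdiff phi (G x) l -> ccont G x -> ccont (phi \o G) x.
Proof.
move=> dphi /ccont_epsP cG; apply/ccont_epsP => e e0.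
pose L := normc l + 1; have L0 : 0 < L by rewrite /L ltr_wpDl// normc_ge0.
have [d d0 Hd] := dphi _ ltr01.
pose e' := Num.min (d / 2) (e / L).
have e'0 : 0 < e' by rewrite lt_min !divr_gt0.
have [s s0 Hs] := cG _ e'0; exists s => // t /Hs.
rewrite le_min => /andP[h1 h2] /=.
have := Hd (G t - G x); rewrite [G x + _]addrC subrK => /(_ _) bnd.
have {}bnd := bnd (le_lt_trans h1 _).
have {}bnd : normc (phi (G t) - phi (G x) - l * (G t - G x)) <= 1 * normc (G t - G x).
  by apply: bnd; lra.
have -> : phi (G t) - phi (G x) = (phi (G t) - phi (G x) - l * (G t - G x))
  + l * (G t - G x) by ring.
rewrite (le_trans (le_normcD _ _))// (le_trans (lerD bnd (lexx _)))//.
by rewrite normcM -mulrDl addrC -/L mulrC -ler_pdivlMr.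
Qed.

Lemma cdiff_inv z : z != 0 -> cdiff (fun z => z^-1) z (- (z^-1 ^+ 2)).
Proof.
rewrite -normc_gt0 => z0 e e0.
exists (Num.min (normc z / 2) (e * normc z ^+ 3 / 2)).
  by rewrite lt_min !divr_gt0//= mulr_gt0// exprn_gt0.
move=> h; rewrite lt_min => /andP[h1 h2].
have zh : normc z / 2 <= normc (z + h).
  have : normc z <= normc (z + h) + normc h.
    by have := le_normcB (z + h) h; rewrite addrK.
  lra.
have zh0 : 0 < normc (z + h) by lra.
have z0' : z != 0 by rewrite -normc_gt0.
have zh0' : z + h != 0 by rewrite -normc_gt0.
have -> : (z + h)^-1 - z^-1 - - (z^-1 ^+ 2) * h = h * (h * (z ^- 2 * (z + h)^-1)).
  by field; rewrite z0' zh0'.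
rewrite normcM mulrC ler_wpM2r ?normc_ge0//.
rewrite normcM normcM !normcV normcX.
rewrite mulrA ler_pdivrMr// ler_pdivrMr ?exprn_gt0//.
have := mulr_ge0 (mulr_ge0 (ltW e0) (exprn_ge0 2 (ltW z0)))
  (_ : 0 <= normc (z + h) - normc z / 2).
rewrite subr_ge0 => /(_ zh).
move: h2; move: (normc h) (normc z) (normc (z + h)) => p q w; nra.
Qed.

Lemma cdiffD phi psi (x k l : R[i]) : cdiff phi x k -> cdiff psi x l ->
  cdiff (fun y => phi y + psi y) x (k + l).
Proof.
move=> dk dl e e0; have e20 : 0 < e / 2 by lra.
have [d d0 Hd] := dk _ e20; have [d' d'0 Hd'] := dl _ e20.
exists (Num.min d d'); first by rewrite lt_min d0.
move=> h; rewrite lt_min => /andP[h1 h2].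
rewrite (_ : _ - _ - _ = (phi (x + h) - phi x - k * h) + (psi (x + h) - psi x - l * h)).
  by rewrite (le_trans (le_normcD _ _))// (splitr e) mulrDl lerD ?Hd ?Hd'.
by ring.
Qed.

Lemma cdiffMl phi (x k a : R[i]) : cdiff phi x k ->
  cdiff (fun y => a * phi y) x (a * k).
Proof.
move=> dk e e0; have a0 : 0 < normc a + 1 by rewrite ltr_wpDl// normc_ge0.
have [d d0 Hd] := dk _ (divr_gt0 e0 a0); exists d => // h /Hd h1.
rewrite (_ : _ - _ - _ = a * (phi (x + h) - phi x - k * h)); last by ring.
rewrite normcM (@le_trans _ _ ((normc a + 1) * normc (phi (x + h) - phi x - k * h)))//.
  by rewrite ler_wpM2r ?normc_ge0// lerDl.
by rewrite mulrC -ler_pdivlMr// mulrAC.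
Qed.

Lemma cdiff_cst (a x : R[i]) : cdiff (fun=> a) x 0.
Proof.
move=> e e0; exists 1 => // h _.
by rewrite subrr mul0r subrr normc_0 mulr_ge0 ?normc_ge0// ltW.
Qed.

Lemma cdiff_sum (I : Type) (r : seq I) (phi : I -> R[i] -> R[i]) (k : I -> R[i]) (x : R[i]) :
  (forall j, cdiff (phi j) x (k j)) ->
  cdiff (fun y => \sum_(j <- r) phi j y) x (\sum_(j <- r) k j).
Proof.
move=> dk; elim: r => [|j r IH].
  by under eq_fun do rewrite big_nil; rewrite big_nil; exact: cdiff_cst.
by under eq_fun do rewrite big_cons; rewrite big_cons; exact: (cdiffD (dk j) IH).
Qed.

End ComplexDerivative.

(** * Cauchy's formula for the circle *)

Section CauchyCircle.
Variable R : realType.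
Variables (r : R) (a : R[i]).
Hypotheses (ar : normc a < r).

Let r0 : 0 < r. Proof. exact: le_lt_trans (normc_ge0 a) ar. Qed.

Definition circle_pt (t : R) : R[i] := r%:C * ei t.

(** The Cauchy kernel w / (w - a) at w = r e^(it), that is dw / (w - a) divided
    by i dt. *)
Definition cauchy_kernel (t : R) : R[i] := circle_pt t / (circle_pt t - a).

(** Homotheties centred at a, of ratio exp s: the circle is at s = 0 and shrinks
    to a as s tends to -oo. *)
Definition shrink (s t : R) : R[i] := a + (expR s)%:C * (circle_pt t - a).

Lemma circle_pt_norm t : normc (circle_pt t) = r.
Proof. by rewrite normcM normc_real ei_norm mulr1 gtr0_norm. Qed.

Lemma circle_ptB_ge t : r - normc a <= normc (circle_pt t - a).
Proof.
rewrite lerBlDr -(circle_pt_norm t) -[X in normc X <= _](subrK a).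
exact: le_normcD.
Qed.

Lemma circle_ptB_le t : normc (circle_pt t - a) <= 2 * r.
Proof. by rewrite (le_trans (le_normcB _ _))// circle_pt_norm; have := ar; lra. Qed.

Lemma circle_ptB_neq0 t : circle_pt t - a != 0.
Proof. by rewrite -normc_gt0 (lt_le_trans _ (circle_ptB_ge t))// subr_gt0. Qed.

Lemma cauchy_kernel_bound t : normc (cauchy_kernel t) <= r / (r - normc a).
Proof.
rewrite normcM normcV circle_pt_norm ler_wpM2l ?(ltW r0)//.
rewrite lef_pV2 ?posrE ?circle_ptB_ge// ?subr_gt0//.
by rewrite normc_gt0 circle_ptB_neq0.
Qed.

Lemma cderive_circle_pt t : cderive circle_pt t ('i * circle_pt t).
Proof.
apply: cderive_eq; first exact: cderiveMl (cderive_ei t).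
by rewrite /circle_pt; ring.
Qed.

Lemma cderive_expR (s : R) : cderive (fun s => (expR s)%:C) s (expR s)%:C.
Proof. by split => /=; [exact: is_derive_expR|exact: is_derive_cst]. Qed.

Lemma cderive_shrinkl s t : cderive (fun s => shrink s t) s (shrink s t - a).
Proof.
apply: cderive_eq.
  exact: cderiveD (cderive_cst a s) (cderiveM (cderive_expR s) (cderive_cst _ s)).
by rewrite /shrink; ring.
Qed.

Lemma cderive_shrinkr s t :
  cderive (shrink s) t ('i * cauchy_kernel t * (shrink s t - a)).
Proof.
apply: cderive_eq.
  apply: cderiveD (cderive_cst a t) (cderiveMl _ _).
  exact: cderiveB (cderive_circle_pt t) (cderive_cst _ t).
by rewrite /shrink /cauchy_kernel; field; rewrite circle_ptB_neq0.
Qed.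

Lemma ccont_circle_pt t : ccont circle_pt t.
Proof. exact: cderive_ccont (cderive_circle_pt t). Qed.

Lemma ccont_cauchy_kernel t : ccont cauchy_kernel t.
Proof.
apply: ccontM; first exact: ccont_circle_pt.
apply: (@ccont_comp _ (fun z => z^-1) (fun t => circle_pt t - a)).
  exact: cdiff_inv (circle_ptB_neq0 t).
by apply: cderive_ccont (cderiveB (cderive_circle_pt t) (cderive_cst _ t)).
Qed.

Lemma shrink_dist s t : normc (shrink s t - a) <= expR s * (2 * r).
Proof.
rewrite /shrink addrAC subrr add0r normcM normc_real gtr0_norm ?expR_gt0//.
by rewrite ler_wpM2l ?circle_ptB_le// expR_ge0.
Qed.

Lemma shrink_norm s t : normc (shrink s t) <= Num.max r ((2 * expR s - 1) * r).
Proof.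
have e0 := expR_gt0 s; have p0 := normc_ge0 a; have ar' := ar.
have -> : shrink s t = (1 - expR s)%:C * a + (expR s)%:C * circle_pt t.
  by rewrite rmorphB rmorph1 /shrink; ring.
rewrite (le_trans (le_normcD _ _))// !normcM !normc_real ei_norm mulr1 (gtr0_norm r0).
rewrite (gtr0_norm e0) le_max; apply/orP.
case: (lerP (expR s) 1) => e1.
  by left; nra.
by right; nra.
Qed.

Variables (phi : R[i] -> R[i]) (rho : R).
Hypotheses (rrho : r < rho) (hphi : holo_on_disc phi rho).

(* For ratio T >= 1 the image circle lies in the disc of radius (2 T - 1) r, so T
   may grow up to (1 + rho / r) / 2; exp b is the midpoint between 1 and this
   bound.  Having b > 0 makes the circle itself an interior value of s. *)
Let b : R := ln ((3 + rho / r) / 4).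

Let rr1 : 1 < rho / r. Proof. by rewrite ltr_pdivlMr// mul1r. Qed.

Let b0 : 0 < b. Proof. by rewrite ln_gt0//; have := rr1; lra. Qed.

Lemma shrink_in_disc s t : s <= b -> normc (shrink s t) < rho.
Proof.
move=> sb; rewrite (le_lt_trans (shrink_norm s t))// gt_max rrho/=.
have : expR s <= (3 + rho / r) / 4.
  by rewrite -[leRHS]lnK ?posrE ?ler_expR//; have := rr1; lra.
have := rr1; rewrite -ltr_pdivlMr//; lra.
Qed.

Lemma ccont_shrinkl s t : s <= b -> ccont (fun s => phi (shrink s t)) s.
Proof.
move=> sb; have [l dl] := hphi (shrink_in_disc t sb).
exact: (@ccont_comp _ phi (fun s => shrink s t) s l dl)
  (cderive_ccont (cderive_shrinkl s t)).
Qed.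

Lemma ccont_shrinkr s t : s <= b -> ccont (fun t => phi (shrink s t)) t.
Proof.
move=> sb; have [l dl] := hphi (shrink_in_disc t sb).
exact: (@ccont_comp _ phi (shrink s) t l dl) (cderive_ccont (cderive_shrinkr s t)).
Qed.

Lemma ccont_shrink_kernel s t : s <= b ->
  ccont (fun t => phi (shrink s t) * cauchy_kernel t) t.
Proof. by move=> sb; apply: ccontM; [exact: ccont_shrinkr|exact: ccont_cauchy_kernel]. Qed.

(** Turns an error that is small relative to the displacement in the plane into
    one that is small relative to the sides of the parameter rectangle. *)
Lemma shrink_lipschitz s s' t t' : s <= b -> s' <= b ->
  normc (shrink s' t' - shrink s t) <= 4 * r * expR b * (`|s' - s| + `|t' - t|).
Proof.
move=> sb s'b; have eb := expR_gt0 b.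
have H x x' y : x <= x' -> x' <= b -> normc (shrink x' y - shrink x y) <= 4 * r * expR b * (x' - x).
  move=> xx' x'b; rewrite (_ : 4 * r * expR b = 2 * (expR b * (2 * r))); last by ring.
  apply: (cderive_mvt xx' (fun z _ => cderive_shrinkl z y)) => z /andP[_ zx'].
  rewrite (le_trans (shrink_dist _ _))// ler_wpM2r//; first by rewrite mulr_ge0// ltW.
  by rewrite ler_expR (le_trans zx').
have V x y y' : x <= b -> y <= y' -> normc (shrink x y' - shrink x y) <= 4 * r * expR b * (y' - y).
  move=> xb yy'.
  have bnd z : normc ('i * cauchy_kernel z * (shrink x z - a)) <= expR b * (2 * r).
    rewrite (_ : _ * _ = 'i * (expR x)%:C * circle_pt z); last first.
      by rewrite /shrink /cauchy_kernel; field; rewrite circle_ptB_neq0.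
    rewrite normcM circle_pt_norm normcM normc_real (gtr0_norm (expR_gt0 _)).
    have -> : normc ('i : R[i]) = 1 by rewrite /= expr0n add0r expr1n sqrtr1.
    have : expR x <= expR b by rewrite ler_expR.
    have r0' := r0; move: (expR x) (expR b) eb (expR_gt0 x) => p q q0 p0 pq.
    by rewrite mul1r; nra.
  rewrite (_ : 4 * r * expR b = 2 * (expR b * (2 * r))); last by ring.
  exact: (cderive_mvt yy' (fun z _ => cderive_shrinkr x z) (fun z _ => bnd z)).
rewrite (le_trans (normc_triangle _ (shrink s t') _))// mulrDr lerD//.
  case: (lerP s s') => ss'; first by rewrite H.
  by rewrite normc_distC H// ltW.
case: (lerP t t') => tt'; first by rewrite V.
by rewrite normc_distC V// ltW.
Qed.

(** The form phi(w) dw / (w - a) pulled back by shrink is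
    phi (ds + i kernel dt).  Near a point, phi is affine up to a small error,
    and for phi(w) = A + B (w - a) the form is d(A (s + i l(t)) + B w), where l
    is an antiderivative of the kernel; hence its circulation along a small
    rectangle is negligible compared with the area. *)
Lemma shrink_invariance s0 : s0 <= 0 ->
  turn_integral (fun t => phi (shrink 0 t) * cauchy_kernel t) =
  turn_integral (fun t => phi (shrink s0 t) * cauchy_kernel t).
Proof.
move=> s00; have p0 := tau_ge0 R; have b0' := b0.
have /choice[V dV] (s : R) : exists V : R -> R[i], s <= b -> forall t,
    0 <= t <= 2 * pi -> cderive V t (phi (shrink s t) * cauchy_kernel t).
  case: (lerP s b) => sb; last by exists (fun=> 0).
  have [|V dV] := @cderive_antiderivative _ _ (- 1) (2 * pi + 1) _
     (fun t _ => ccont_shrink_kernel t sb).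
    lra.
  by exists V => _ t ht; apply: dV; lra.
have /choice[H dH] (t : R) : exists H : R -> R[i], forall s, s0 <= s <= 0 ->
    cderive H s (phi (shrink s t)).
  have [||H dH] := @cderive_antiderivative _ (fun s => phi (shrink s t)) (s0 - 1) b.
  - lra.
  - by move=> x /andP[_ xb]; exact: ccont_shrinkl.
  - by exists H => s hs; apply: dH; lra.
have [l dl] : exists l, forall t, 0 <= t <= 2 * pi -> cderive l t (cauchy_kernel t).
  have [|l dl] := @cderive_antiderivative _ _ (- 1) (2 * pi + 1) _
     (fun t _ => ccont_cauchy_kernel t).
    lra.
  by exists l => t ht; apply: dl; lra.
(* V and H integrate the pulled back form along the vertical and the horizontal
   edges, so the mixed difference of W is the circulation along a rectangle. *)
pose W s t := 'i * V s t - H t s.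
have dW0 : mixed_difference W s0 0 0 (2 * pi) = 0.
  apply: mixed_difference_eq0 => // x y hx hy e e0.
  have xb : x <= b by lra.
  have [B dB] := hphi (shrink_in_disc y xb).
  pose zs := shrink x y; pose A := phi zs + B * (a - zs).
  pose C := 4 * r * expR b; have C0 : 0 < C by rewrite !mulr_gt0// expR_gt0.
  pose K := 1 + r / (r - normc a).
  have K0 : 0 < K.
    have : 0 < r / (r - normc a) by rewrite divr_gt0// subr_gt0.
    by rewrite /K; lra.
  pose e1 := e / (4 * C * K); have e10 : 0 < e1 by rewrite divr_gt0// mulr_gt0// mulr_gt0.
  have [d d0 Hd] := dB _ e10.
  exists (d / (2 * C)); first by rewrite divr_gt0// mulr_gt0.
  move=> u u' v v' s0u /andP[ux xu'] u'0 v0 /andP[vy yv'] v'p ulen vlen.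
  set h := u' - u + (v' - v).
  have h0 : 0 <= h by rewrite /h; lra.
  have hd : C * h < d.
    rewrite mulrC -ltr_pdivlMr//.
    have E : d / (2 * C) = d / C / 2 by field; rewrite gt_eqF.
    by rewrite /h; lra.
  have err s t : u <= s <= u' -> v <= t <= v' ->
      normc (phi (shrink s t) - (A + B * (shrink s t - a))) <= e1 * (C * h).
    move=> hs ht; have sb : s <= b by lra.
    have D : normc (shrink s t - zs) <= C * h.
      rewrite (le_trans (shrink_lipschitz _ _ xb sb))// ler_wpM2l ?(ltW C0)//.
      by rewrite /h lerD//; rewrite ler_norml; apply/andP; split; lra.
    have := Hd _ (le_lt_trans D hd); rewrite -/zs [zs + _]addrC subrK => bnd.
    rewrite (_ : _ - _ = phi (shrink s t) - phi zs - B * (shrink s t - zs)); last first.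
      by rewrite /A; ring.
    by rewrite (le_trans bnd)// ler_wpM2l ?(ltW e10).
  (* The primitive of the form for the affine part of phi. *)
  pose P s t := A * (s%:C + 'i * l t) + B * shrink s t.
  have edgeV s : u <= s <= u' ->
      normc (('i * V s v' - P s v') - ('i * V s v - P s v)) <= 2 * (e1 * (C * h) * K) * (v' - v).
    move=> hs; have sb : s <= b by lra.
    apply: (@cderive_mvt _ (fun t => 'i * V s t - P s t) (fun t => 'i * cauchy_kernel t *
       (phi (shrink s t) - (A + B * (shrink s t - a))))).
    - lra.
    - move=> t ht; have ht' : 0 <= t <= 2 * pi by lra.
      apply: cderive_eq; first apply: cderiveB; first exact: cderiveMl (dV s sb t ht').
        apply: cderiveD; last exact: cderiveMl (cderive_shrinkr s t).
        by apply: cderiveMl; apply: cderiveD (cderive_cst _ t) _; exact: cderiveMl (dl t ht').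
      by ring.
    - move=> t ht; rewrite normcM mulrC ler_pM ?normc_ge0 ?err//.
      rewrite normcM (_ : normc ('i : R[i]) = 1) ?mul1r; last first.
        by rewrite /= expr0n add0r expr1n sqrtr1.
      by rewrite (le_trans (cauchy_kernel_bound t))// /K lerDr.
  have edgeH t : v <= t <= v' ->
      normc ((H t u' - P u' t) - (H t u - P u t)) <= 2 * (e1 * (C * h) * K) * (u' - u).
    move=> ht.
    apply: (@cderive_mvt _ (fun s => H t s - P s t) (fun s =>
       (phi (shrink s t) - (A + B * (shrink s t - a))))).
    - lra.
    - move=> s hs; have hs' : s0 <= s <= 0 by lra.
      apply: cderive_eq; first apply: cderiveB (dH t s hs') _.
        apply: cderiveD; last exact: cderiveMl (cderive_shrinkl s t).
        by apply: cderiveMl; apply: cderiveD (cderive_real s) (cderive_cst _ s).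
      by ring.
    - move=> s hs; rewrite (le_trans (err s t hs ht))// ler_peMr//.
        exact: mulr_ge0 (ltW e10) (mulr_ge0 (ltW C0) h0).
      by rewrite /K lerDl divr_ge0 ?(ltW r0)// subr_ge0 ltW.
  have uu : u <= u <= u' by lra.
  have uu' : u <= u' <= u' by lra.
  have vv : v <= v <= v' by lra.
  have vv' : v <= v' <= v' by lra.
  have E1 := edgeV _ uu; have E2 := edgeV _ uu'.
  have E3 := edgeH _ vv; have E4 := edgeH _ vv'.
  rewrite (_ : mixed_difference W u u' v v' =
     (('i * V u' v' - P u' v') - ('i * V u' v - P u' v))
     - (('i * V u v' - P u v') - ('i * V u v - P u v))
     - ((H v' u' - P u' v') - (H v' u - P u v'))
     + ((H v u' - P u' v) - (H v u - P u v))); last first.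
    by rewrite /mixed_difference /W; ring.
  rewrite (le_trans (le_normcD _ _))// (le_trans (lerD (le_normcB _ _) (lexx _)))//.
  rewrite (le_trans (lerD (lerD (le_normcB _ _) (lexx _)) (lexx _)))//.
  rewrite (le_trans (lerD (lerD (lerD E2 E1) E4) E3))//.
  rewrite le_eqVlt; apply/orP; left; apply/eqP.
  by rewrite /e1 /h; field; rewrite (gt_eqF C0) (gt_eqF K0).
have [c1 c2] : 0 <= b /\ s0 <= b by lra.
rewrite (turn_integralE (ex_intro2 _ _ (V 0) (dV 0 c1) erefl)).
rewrite (turn_integralE (ex_intro2 _ _ (V s0) (dV s0 c2) erefl)).
(* The edges t = 0 and t = 2 pi carry the same integral. *)
have per s : s0 <= s <= 0 -> shrink s (2 * pi) = shrink s 0.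
  by rewrite /shrink /circle_pt ei_tau ei0.
have EH : H (2 * pi) 0 - H 0 0 = H (2 * pi) s0 - H 0 s0.
  apply: (cderive0_const (F := fun s => H (2 * pi) s - H 0 s)) => // s hs.
  apply: cderive_eq; first exact: cderiveB (dH _ s hs) (dH _ s hs).
  by rewrite per// subrr.
move: dW0; rewrite /mixed_difference /W.
rewrite [X in X = 0 -> _](_ : _ = 'i * ((V 0 (2 * pi) - V 0 0) - (V s0 (2 * pi) - V s0 0))
  - ((H (2 * pi) 0 - H 0 0) - (H (2 * pi) s0 - H 0 s0))); last by ring.
rewrite EH subrr subr0 => /eqP; rewrite mulf_eq0 => /orP[|].
  by rewrite eq_complex/= eqxx oner_eq0.
by rewrite subr_eq0 => /eqP.
Qed.

(** Shrinking the circle to its centre replaces phi by phi a under the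
    integral. *)
Lemma turn_integral_cauchy :
  turn_integral (fun t => phi (circle_pt t) * cauchy_kernel t)
  = phi a * turn_integral cauchy_kernel.
Proof.
have sh0 t : shrink 0 t = circle_pt t by rewrite /shrink expR0 mul1r subrKC.
have b0' := b0; have p0 := tau_gt0 R.
have cK t := ccont_cauchy_kernel t.
have K0 : 0 < r / (r - normc a) by rewrite divr_gt0// subr_gt0.
apply: eqc_norm0 => e e0.
pose e1 := e / (2 * (r / (r - normc a)) * (2 * pi)).
have e10 : 0 < e1 by rewrite divr_gt0// mulr_gt0// mulr_gt0.
have [B dB] := hphi (lt_trans ar rrho).
have [d d0 Hd] : exists2 d, 0 < d & forall z, normc (z - a) < d -> normc (phi z - phi a) <= e1.
  have [d d0 Hd] := dB _ ltr01.
  exists (Num.min d (e1 / (normc B + 1))).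
    by rewrite lt_min d0 divr_gt0// ltr_wpDl// normc_ge0.
  move=> z; rewrite lt_min => /andP[zd ze].
  have := Hd _ zd; rewrite [a + _]addrC subrK => bnd.
  have -> : phi z - phi a = (phi z - phi a - B * (z - a)) + B * (z - a) by ring.
  rewrite (le_trans (le_normcD _ _))// (le_trans (lerD bnd (lexx _)))//.
  rewrite normcM -mulrDl [1 + _]addrC mulrC -ler_pdivlMr ?ltW//.
  by rewrite ltr_wpDl// normc_ge0.
have [s0 s00 hs0] : exists2 s0, s0 <= 0 & expR s0 * (2 * r) < d.
  pose q := Num.min 1 (d / (4 * r)).
  have q0 : 0 < q by rewrite lt_min ltr01 divr_gt0// mulr_gt0.
  exists (ln q); first by rewrite ln_le0// ge_min lexx.
  rewrite lnK ?posrE// -ltr_pdivlMr ?mulr_gt0//.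
  have E : d / (4 * r) = d / (2 * r) / 2 by field; rewrite gt_eqF.
  have F : 0 < d / (2 * r) by rewrite divr_gt0// mulr_gt0.
  rewrite (@le_lt_trans _ _ (d / (4 * r)))//; first by rewrite ge_min lexx orbT.
  lra.
have s0b : s0 <= b by lra.
under [in X in turn_integral X]eq_fun do rewrite -sh0.
rewrite (shrink_invariance s00) -turn_integralMl//.
have -> : turn_integral (fun t => phi (shrink s0 t) * cauchy_kernel t) =
   turn_integral (fun t => phi a * cauchy_kernel t)
   + turn_integral (fun t => (phi (shrink s0 t) - phi a) * cauchy_kernel t).
  rewrite -turn_integralD//.
  - by congr turn_integral; apply/funext => t; ring.
  - by move=> t; apply: ccontM => //; exact: ccont_cst.
  - move=> t; apply: ccontM => //; apply: ccontD; first exact: ccont_shrinkr.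
    exact: ccont_cst.
rewrite addrAC subrr add0r.
rewrite (_ : e = 2 * (e1 * (r / (r - normc a))) * (2 * pi)); last first.
  move: K0 p0; rewrite /e1; move: (r / (r - normc a)) (2 * pi) => k p k0 p0.
  by field; rewrite !gt_eqF.
apply: turn_integral_bound => [t|t _].
  apply: ccontM => //; apply: ccontD; first exact: ccont_shrinkr.
  exact: ccont_cst.
rewrite normcM ler_pM ?normc_ge0 ?cauchy_kernel_bound//.
by apply: Hd; rewrite (le_lt_trans (shrink_dist _ _)).
Qed.

End CauchyCircle.

(** * Power series in one variable *)

Section ComplexLimit.
Variable R : realType.
Implicit Types (u v : nat -> R[i]) (k l : R[i]).

(** Limits of complex sequences with real error bounds. *)
Definition ctends u l : Prop :=
  forall e : R, 0 < e -> exists N, forall n, (N <= n)%N -> normc (u n - l) <= e.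

Lemma ctends_unique u k l : ctends u k -> ctends u l -> k = l.
Proof.
move=> uk ul; apply: eqc_norm0 => e e0.
have e20 : 0 < e / 2 by rewrite divr_gt0.
have [N HN] := uk _ e20; have [M HM] := ul _ e20.
rewrite (le_trans (normc_triangle k (u (maxn N M)) l))// (splitr e) lerD//.
  by rewrite normc_distC HN// leq_maxl.
by rewrite HM// leq_maxr.
Qed.

Lemma ctends_eventually u v l N :
  (forall n, (N <= n)%N -> u n = v n) -> ctends u l -> ctends v l.
Proof.
move=> uv ul e e0; have [M HM] := ul _ e0; exists (maxn N M) => n.
by rewrite geq_max => /andP[nN nM]; rewrite -uv ?HM.
Qed.

Lemma ctends_cst l : ctends (fun=> l) l.
Proof. by move=> e e0; exists 0%N => n _; rewrite subrr normc_0 ltW. Qed.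

Lemma ctendsD u v k l : ctends u k -> ctends v l ->
  ctends (fun n => u n + v n) (k + l).
Proof.
move=> uk vl e e0; have e20 : 0 < e / 2 by rewrite divr_gt0.
have [N HN] := uk _ e20; have [M HM] := vl _ e20.
exists (maxn N M) => n; rewrite geq_max => /andP[nN nM].
rewrite opprD addrACA (le_trans (le_normcD _ _))// (splitr e) lerD//.
  exact: HN.
exact: HM.
Qed.

Lemma ctendsMl a u l : ctends u l -> ctends (fun n => a * u n) (a * l).
Proof.
move=> ul e e0; have a0 : 0 < normc a + 1 by rewrite ltr_wpDl// normc_ge0.
have [N HN] := ul _ (divr_gt0 e0 a0); exists N => n nN.
rewrite -mulrBr normcM (@le_trans _ _ ((normc a + 1) * normc (u n - l)))//.
  by rewrite ler_wpM2r ?normc_ge0// lerDl.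
by rewrite mulrC -ler_pdivlMr// HN.
Qed.

Lemma ctendsB u v k l : ctends u k -> ctends v l ->
  ctends (fun n => u n - v n) (k - l).
Proof.
move=> uk vl; have := ctendsD uk (ctendsMl (- 1) vl).
by rewrite mulN1r; under [fun n => _ + _]funext do rewrite mulN1r.
Qed.

Lemma ctends_bound u l (M : R) N : ctends u l ->
  (forall n, (N <= n)%N -> normc (u n) <= M) -> normc l <= M.
Proof.
move=> ul bu; apply/ler_addgt0Pr => e e0; have [N' HN] := ul e e0.
have -> : l = u (maxn N N') - (u (maxn N N') - l) by ring.
rewrite (le_trans (le_normcB _ _))// lerD//.
  by rewrite bu// leq_maxl.
by rewrite HN// leq_maxr.
Qed.

Lemma geometric_small (C q e : R) : 0 <= q < 1 -> 0 < e ->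
  exists N, forall n, (N <= n)%N -> C * q ^+ n <= e.
Proof.
move=> /andP[q0 q1] e0; have C0 : 0 < `|C| + 1 by rewrite ltr_wpDl.
have /cvgrPdist_le cq : (fun n => q ^+ n) @ \oo --> (0 : R).
  by apply: cvg_expr; rewrite ger0_norm.
have [N _ HN] := cq _ (divr_gt0 e0 C0); exists N => n /HN /=.
rewrite sub0r normrN ger0_norm ?exprn_ge0// ler_pdivlMr// => h.
rewrite (le_trans _ h)// mulrC ler_wpM2l ?exprn_ge0//.
by rewrite (le_trans (ler_norm C))// lerDl.
Qed.

End ComplexLimit.

Section PowerSeries.
Variable R : realType.
Implicit Types (phi psi : R[i] -> R[i]) (c d : nat -> R[i]) (z : R[i]) (r : R).

Definition psum c z (n : nat) : R[i] := \sum_(m < n) c m * z ^+ m.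

Definition expands phi r c : Prop :=
  forall z, normc z < r -> ctends (psum c z) (phi z).

Lemma expands_term_bound phi r c x : expands phi r c -> 0 <= x < r ->
  exists K, 0 <= K /\ forall m, normc (c m) * x ^+ m <= K.
Proof.
move=> ex /andP[x0 xr].
have [||N HN] := ex x%:C _ 1; first by rewrite normc_real ger0_norm.
  by [].
have s0 : 0 <= \sum_(m < N) normc (c m) * x ^+ m.
  by apply: sumr_ge0 => m _; rewrite mulr_ge0 ?normc_ge0 ?exprn_ge0.
exists (2 + \sum_(m < N) normc (c m) * x ^+ m); split; first by rewrite addr_ge0.
move=> m; case: (ltnP m N) => [mN|Nm].
  rewrite (bigD1 (Ordinal mN))//= addrCA lerDl addr_ge0//.
  by apply: sumr_ge0 => i _; rewrite mulr_ge0 ?normc_ge0 ?exprn_ge0.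
have := lerD (HN m.+1 (leqW Nm)) (HN m Nm) => h.
have -> : normc (c m) * x ^+ m = normc (c m * x%:C ^+ m).
  by rewrite normcM normcX normc_real ger0_norm.
have -> : c m * x%:C ^+ m = (psum c x%:C m.+1 - phi x%:C) - (psum c x%:C m - phi x%:C).
  by rewrite /psum big_ord_recr /=; ring.
rewrite (le_trans (le_normcB _ _))// (le_trans h)//; lra.
Qed.

(** On half the radius where the coefficients are controlled, the remainder is
    dominated by a geometric series of ratio at most 1/2, hence by twice its
    first term. *)
Lemma expands_tail phi r c s K z n : expands phi r c ->
  0 < s -> 0 <= K -> (forall m, normc (c m) * s ^+ m <= K) ->
  normc z < r -> normc z <= s / 2 ->
  normc (phi z - psum c z n) <= 2 * K * (normc z / s) ^+ n.
Proof.
move=> ex s0 K0 bc zr zs; set q := normc z / s.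
have q0 : 0 <= q by rewrite divr_ge0 ?normc_ge0// ltW.
have Kq : 0 <= K * q ^+ n by exact: mulr_ge0 K0 (exprn_ge0 n q0).
have q12 : q <= 2^-1 by rewrite ler_pdivrMr// mulrC.
have term m : normc (c m * z ^+ m) <= K * q ^+ m.
  rewrite normcM normcX (_ : normc z = q * s); last by rewrite divfK// gt_eqF.
  by rewrite exprMn mulrCA mulrC ler_wpM2r ?exprn_ge0.
have part j : normc (psum c z (n + j) - psum c z n) <= K * q ^+ n * (2 - 2 * 2^-1 ^+ j).
  elim: j => [|j IH].
    by rewrite addn0 subrr normc_0 expr0 mulr1 subrr mulr0.
  rewrite addnS /psum big_ord_recr /= -/(psum c z (n + j)) -/(psum c z n) addrAC.
  rewrite (le_trans (le_normcD _ _))// (le_trans (lerD IH (term _)))//.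
  have e1 : K * q ^+ (n + j) <= K * q ^+ n * 2^-1 ^+ j.
    rewrite exprD mulrA ler_wpM2l//.
    by apply: lerXn2r; rewrite ?nnegrE.
  rewrite (le_trans (lerD (lexx _) e1))// -mulrDr ler_wpM2l//.
  by rewrite exprS; move: (2^-1 ^+ j) => y; lra.
apply: (ctends_bound (u := fun m => psum c z m - psum c z n) (N := n)).
  exact: ctendsB (ex z zr) (@ctends_cst _ _).
move=> m /subnKC <-; rewrite (le_trans (part _))//.
rewrite [leRHS](_ : _ = K * q ^+ n * 2); last by ring.
by rewrite ler_wpM2l// gerBl mulr_ge0// exprn_ge0// invr_ge0.
Qed.

(** If e_m is the first nonzero coefficient of the difference, the tail estimate
    gives |e_m| x^m = O(x^(m+1)) as x tends to 0. *)
Lemma expands_unique phi psi r s c d : 0 < r -> 0 < s ->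
  (forall z, normc z < Num.min r s -> phi z = psi z) ->
  expands phi r c -> expands psi s d -> c =1 d.
Proof.
move=> r0 s0 eqp exc exd; pose t := Num.min r s.
have t0 : 0 < t by rewrite lt_min r0.
pose e m := c m - d m.
have exe : expands (fun=> 0) t e.
  move=> z zt; have [zr zs] : normc z < r /\ normc z < s.
    by move: zt; rewrite lt_min => /andP.
  rewrite -(subrr (phi z)) {2}(eqp z zt).
  have := ctendsB (exc z zr) (exd z zs); congr ctends; apply/funext => n.
  by rewrite /psum -sumrB; apply: eq_bigr => m _; rewrite -mulrBl.
have [|K [K0 HK]] := expands_term_bound exe (x := t / 2).
  by apply/andP; split; lra.
have t20 : 0 < t / 2 by lra.
suff e0 m : e m = 0 by move=> m; apply/eqP; rewrite -subr_eq0 -/(e m) e0.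
elim/ltn_ind: m => m IH; apply: eqc_norm0 => y y0; rewrite subr0.
(* x is so small that the tail bound 2 K (2 x / t)^(m+1) is at most y x^m. *)
pose x := Num.min (t / 4) (y / (2 * K + 1) * (t / 2) ^+ m.+1).
have x0 : 0 < x.
  by rewrite lt_min divr_gt0//= mulr_gt0 ?exprn_gt0// divr_gt0//; lra.
have x4 : x <= t / 4 by rewrite ge_min lexx.
have nx : normc (x%:C : R[i]) = x by rewrite normc_real gtr0_norm.
have zt : normc (x%:C : R[i]) < t by rewrite nx; lra.
have zt2 : normc (x%:C : R[i]) <= t / 2 / 2 by rewrite nx; lra.
have ps : psum e x%:C m.+1 = e m * x%:C ^+ m.
  by rewrite /psum big_ord_recr big1 /= ?add0r// => i _; rewrite IH ?mul0r.
have := expands_tail m.+1 exe t20 K0 HK zt zt2.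
rewrite nx ps normc_distC subr0 normcM normcX nx => tl.
have X0 : 0 < x ^+ m by rewrite exprn_gt0.
rewrite -(ler_pM2r X0) (le_trans tl)//.
have xy : x <= y / (2 * K + 1) * (t / 2) ^+ m.+1 by rewrite ge_min lexx orbT.
rewrite expr_div_n exprS mulrA ler_pdivrMr ?exprn_gt0// mulrA [leRHS]mulrAC.
rewrite ler_pM2r// (le_trans (ler_wpM2l _ xy)) ?mulr_ge0//.
rewrite mulrA ler_pM2r ?exprn_gt0// mulrCA ler_piMr ?(ltW y0)//.
by rewrite ler_pdivrMr; lra.
Qed.

End PowerSeries.

(** * Taylor expansion of holomorphic functions of one variable *)

Section CauchyExpansion.
Variable R : realType.
Implicit Types (phi chi : R[i] -> R[i]) (z a : R[i]) (r rho : R).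

(** Cauchy's integral for the m-th Taylor coefficient, over the circle of
    radius r. *)
Definition taylor_coef phi r (m : nat) : R[i] :=
  ((2 * pi : R)%:C)^-1 *
  turn_integral (fun t => (circle_pt r t)^-1 ^+ m * phi (circle_pt r t)).

Lemma tau_neq0 : (2 * pi : R)%:C != 0.
Proof. by rewrite -normc_gt0 normc_real gtr0_norm tau_gt0. Qed.

Lemma circle_pt_neq0 r t : 0 < r -> circle_pt r t != 0.
Proof.
by move=> r0; rewrite -normc_gt0 (@circle_pt_norm _ _ 0) ?normc_0.
Qed.

Lemma cauchy_kernel_geometric r a t n : normc a < r ->
  cauchy_kernel r a t = \sum_(m < n) (a * (circle_pt r t)^-1) ^+ m
    + (a * (circle_pt r t)^-1) ^+ n * cauchy_kernel r a t.
Proof.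
move=> ar; have w0 := circle_pt_neq0 t (le_lt_trans (normc_ge0 a) ar).
have wa0 := circle_ptB_neq0 ar t.
elim: n => [|n IH]; first by rewrite big_ord0 add0r mul1r.
rewrite [LHS]IH big_ord_recr /= -addrA; congr (_ + _).
rewrite exprSr; move: ((a * _) ^+ n) => x.
by rewrite /cauchy_kernel; field; rewrite w0 wa0.
Qed.

Lemma ccont_circle_ptVX r m t : 0 < r ->
  ccont (fun t => (circle_pt r t)^-1 ^+ m) t.
Proof.
move=> r0; elim: m => [|m IH].
  by under eq_fun do rewrite expr0; exact: ccont_cst.
under eq_fun do rewrite exprS; apply: ccontM => //.
apply: (@ccont_comp _ (fun z => z^-1) (circle_pt r)).
  exact: cdiff_inv (circle_pt_neq0 t r0).
exact: ccont_circle_pt.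
Qed.

(** Replacing the Cauchy kernel by a partial geometric sum costs a geometric
    error; both sides of Cauchy's formula are expanded with it. *)
Lemma turn_integral_kernel (F : R -> R[i]) r a (B : R) : normc a < r ->
  (forall t, ccont F t) -> (forall t, 0 <= t <= 2 * pi -> normc (F t) <= B) ->
  ctends (fun n => \sum_(m < n) a ^+ m *
      turn_integral (fun t => (circle_pt r t)^-1 ^+ m * F t))
    (turn_integral (fun t => F t * cauchy_kernel r a t)).
Proof.
move=> ar cF bF e e0; have r0 := le_lt_trans (normc_ge0 a) ar.
have h00 : 0 <= (0 : R) <= 2 * pi by rewrite lexx tau_ge0.
have B0 : 0 <= B := le_trans (normc_ge0 _) (bF 0 h00).
set K := r / (r - normc a).
have q01 : 0 <= normc a / r < 1.
  by rewrite divr_ge0 ?normc_ge0 ?(ltW r0)//= ltr_pdivrMr// mul1r.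
have [N HN] := geometric_small (2 * (B * K) * (2 * pi)) q01 e0.
exists N => n /HN; apply: le_trans.
have cm m t : ccont (fun t => (circle_pt r t)^-1 ^+ m * F t) t.
  by apply: ccontM => //; exact: ccont_circle_ptVX.
have [cs <-] := turn_integral_sum (fun m => a ^+ m) n cm.
pose E t := (a * (circle_pt r t)^-1) ^+ n * (F t * cauchy_kernel r a t).
have cK t : ccont (cauchy_kernel r a) t by exact: ccont_cauchy_kernel.
have cE t : ccont E t.
  apply: ccontM; last exact: ccontM.
  under eq_fun do rewrite exprMn; apply: ccontM; first exact: ccont_cst.
  exact: ccont_circle_ptVX.
have -> : (fun t => F t * cauchy_kernel r a t) =
   (fun t => \sum_(m < n) a ^+ m * ((circle_pt r t)^-1 ^+ m * F t) + E t).
  apply/funext => t; rewrite {1}(cauchy_kernel_geometric t n ar) mulrDr mulr_sumr /E.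
  congr (_ + _); last by ring.
  by apply: eq_bigr => m _; rewrite exprMn; ring.
rewrite turn_integralD// opprD addrA subrr sub0r normcN.
rewrite (_ : _ * _ ^+ n = 2 * ((normc a / r) ^+ n * (B * K)) * (2 * pi)); last by ring.
apply: turn_integral_bound => // t ht.
rewrite normcM normcX normcM normcV (circle_pt_norm ar) normcM.
rewrite ler_wpM2l ?exprn_ge0 ?divr_ge0 ?normc_ge0 ?(ltW r0)//.
by rewrite ler_pM ?normc_ge0 ?bF// cauchy_kernel_bound.
Qed.

Lemma circle_pt_VE r t m : (circle_pt r t)^-1 ^+ m = (r%:C)^-1 ^+ m * (ei t)^-1 ^+ m.
Proof. by rewrite /circle_pt invfM exprMn. Qed.

(** The winding number of the circle around a, computed by expanding the kernel
    for the constant function 1. *)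
Lemma turn_integral_cauchy_kernel r a : normc a < r ->
  turn_integral (cauchy_kernel r a) = (2 * pi)%:C.
Proof.
move=> ar; have r0 := le_lt_trans (normc_ge0 a) ar.
have b1 (t : R) : 0 <= t <= 2 * pi -> normc (1 : R[i]) <= 1 by rewrite normc_1.
have := turn_integral_kernel ar (fun t => @ccont_cst _ 1 t) b1.
have -> : (fun t => 1 * cauchy_kernel r a t) = cauchy_kernel r a.
  by apply/funext => t; rewrite mul1r.
move=> lim; apply: ctends_unique lim _.
apply: (@ctends_eventually _ (fun=> (2 * pi)%:C) _ _ 1%N); last exact: ctends_cst.
move=> [//|n] _; rewrite big_ord_recl big1 ?addr0 => [|m _].
  rewrite expr0 mul1r (_ : (fun t => _) = (fun t => (ei t)^-1 ^+ 0)).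
    by rewrite turn_integral_eiVX.
  by apply/funext => t; rewrite !expr0 mulr1.
rewrite (_ : (fun t => _) = (fun t => (r%:C)^-1 ^+ m.+1 * (ei t)^-1 ^+ m.+1)).
  rewrite turn_integralMl; first by rewrite turn_integral_eiVX/= !mulr0.
  by move=> t; apply: cderive_ccont (cderive_eiVX _ _).
by apply/funext => t; rewrite mulr1 circle_pt_VE.
Qed.

Lemma ccont_on_circle phi r rho t : 0 < r < rho -> holo_on_disc phi rho ->
  ccont (fun t => phi (circle_pt r t)) t.
Proof.
move=> /andP[r0 rrho] hphi; have z0 : normc (0 : R[i]) < r by rewrite normc_0.
have [|l dl] := hphi (circle_pt r t); first by rewrite (circle_pt_norm z0).
exact: (@ccont_comp _ phi (circle_pt r) t l dl) (ccont_circle_pt r t).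
Qed.

Lemma circle_bounded phi r rho : 0 < r < rho -> holo_on_disc phi rho ->
  exists B, forall t, 0 <= t <= 2 * pi -> normc (phi (circle_pt r t)) <= B.
Proof.
move=> rr hphi.
have aux (f : R -> R) : (forall t, {for t, continuous f}) ->
    exists B, forall t, 0 <= t <= 2 * pi -> `|f t| <= B.
  move=> cf; have [|c _ Hc] := @EVT_max R (fun t => `|f t|) 0 (2 * pi) (tau_ge0 R).
    by apply: continuous_subspaceT => t; apply: cvg_norm; exact: cf.
  by exists `|f c| => t ht; apply: Hc; rewrite in_itv.
have [B1 H1] := aux _ (fun t => (ccont_on_circle t rr hphi).1).
have [B2 H2] := aux _ (fun t => (ccont_on_circle t rr hphi).2).
exists (B1 + B2) => t ht; rewrite (le_trans (normc_le_ReIm _))//.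
by rewrite lerD ?H1 ?H2.
Qed.

(** Cauchy's formula with both integrals expanded: the error made at order n is
    of size (|a| / r)^n. *)
Theorem cauchy_expansion phi r rho : 0 < r < rho -> holo_on_disc phi rho ->
  expands phi r (taylor_coef phi r).
Proof.
move=> rr hphi a ar; have /andP[r0 rrho] := rr.
have [B bB] := circle_bounded rr hphi.
have := turn_integral_kernel ar (fun t => ccont_on_circle t rr hphi) bB.
rewrite (turn_integral_cauchy ar rrho hphi) turn_integral_cauchy_kernel//.
move=> /(ctendsMl ((2 * pi)%:C)^-1).
rewrite mulrCA mulVf ?tau_neq0// mulr1; congr ctends; apply/funext => n.
rewrite mulr_sumr; apply: eq_bigr => m _; rewrite /taylor_coef.
by rewrite mulrCA mulrC.
Qed.

Lemma taylor_coef_bound phi r rho B m : 0 < r < rho -> holo_on_disc phi rho ->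
  (forall t, 0 <= t <= 2 * pi -> normc (phi (circle_pt r t)) <= B) ->
  normc (taylor_coef phi r m) * r ^+ m <= 2 * B.
Proof.
move=> rr hphi bB; have /andP[r0 rrho] := rr; have p0 := tau_gt0 R.
have z0 : normc (0 : R[i]) < r by rewrite normc_0.
rewrite normcM normcV normc_real (gtr0_norm p0) -mulrA mulrC ler_pdivrMr//.
have rm : 0 < r ^+ m by rewrite exprn_gt0.
rewrite -ler_pdivlMr// (_ : _ / _ = 2 * (r ^- m * B) * (2 * pi)); last by ring.
apply: turn_integral_bound => [t|t ht].
  apply: ccontM; [exact: ccont_circle_ptVX|exact: ccont_on_circle rr hphi].
rewrite normcM normcX normcV (circle_pt_norm z0) exprVn.
by rewrite ler_wpM2l ?bB// invr_ge0 ltW.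
Qed.

(** The derivative of phi(w) w^-m with respect to the angle integrates to zero
    along the closed circle; this avoids differentiating a series term by
    term. *)
Lemma taylor_coef_radial phi phi' r rho : 0 < r < rho ->
  (forall z, normc z < rho -> cdiff phi z (phi' z)) ->
  holo_on_disc (fun z => z * phi' z) rho ->
  forall m, taylor_coef (fun z => z * phi' z) r m = m%:R * taylor_coef phi r m.
Proof.
move=> rr dphi hchi m; have /andP[r0 rrho] := rr.
have z0 : normc (0 : R[i]) < r by rewrite normc_0.
have hphi : holo_on_disc phi rho by move=> z /dphi; exists (phi' z).
pose w := circle_pt r.
have wr t : normc (w t) < rho by rewrite (circle_pt_norm z0).
have c1 t : ccont (fun t => (w t)^-1 ^+ m * phi (w t)) t.
  apply: ccontM; [exact: ccont_circle_ptVX|exact: ccont_on_circle rr hphi].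
have c2 t : ccont (fun t => (w t)^-1 ^+ m * (w t * phi' (w t))) t.
  apply: ccontM; [exact: ccont_circle_ptVX|exact: ccont_on_circle rr hchi].
have c3 t : ccont (fun t => - m%:R * ((w t)^-1 ^+ m * phi (w t))) t.
  by apply: ccontM => //; exact: ccont_cst.
suff : turn_integral (fun t => (w t)^-1 ^+ m * (w t * phi' (w t))
    + - m%:R * ((w t)^-1 ^+ m * phi (w t))) = 0.
  rewrite turn_integralD// turn_integralMl// mulNr => /eqP.
  by rewrite subr_eq0 => /eqP e; rewrite /taylor_coef e mulrCA.
apply: turn_integralE.
exists (fun t => - 'i * ((w t)^-1 ^+ m * phi (w t))); last first.
  by rewrite /w /circle_pt ei_tau ei0 subrr.
move=> t _.
have d1 : cderive (fun t => (w t)^-1 ^+ m) t (m%:R * - 'i * (w t)^-1 ^+ m).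
  rewrite (_ : (fun t => _) = (fun t => (r%:C)^-1 ^+ m * (ei t)^-1 ^+ m)); last first.
    by apply/funext => s; exact: circle_pt_VE.
  apply: cderive_eq; first exact: cderiveMl (cderive_eiVX m t).
  by rewrite circle_pt_VE; ring.
have d2 : cderive (phi \o w) t (phi' (w t) * ('i * w t)).
  exact: cdiff_comp (dphi _ (wr t)) (cderive_circle_pt _ _).
apply: cderive_eq; first exact: cderiveMl (cderiveM d1 d2).
rewrite [RHS](_ : _ = - 'i ^+ 2 * ((w t)^-1 ^+ m * (w t * phi' (w t)) +
    - m%:R * ((w t)^-1 ^+ m * phi (w t)))); last by rewrite sqr_i opprK mul1r.
by rewrite /=; ring.
Qed.

(** Cauchy's bound 2 M (2 / rho)^m for the coefficients on the circle of radius
    rho / 2 gives both parts, once the coefficients of order 0 and 1 are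
    identified with phi 0 and the derivative. *)
Lemma cauchy_estimate phi rho M l : 0 < rho -> holo_on_disc phi rho ->
  (forall z, normc z < rho -> normc (phi z) <= M) -> cdiff phi 0 l ->
  normc l <= 4 * M / rho /\
  forall z, normc z <= rho / 4 ->
    normc (phi z - phi 0 - l * z) <= 16 * M / rho ^+ 2 * normc z ^+ 2.
Proof.
move=> rho0 hphi bM dl.
have M0 : 0 <= M by apply: le_trans (normc_ge0 _) (bM 0 _); rewrite normc_0.
have rr : 0 < rho / 2 < rho by apply/andP; split; lra.
have r0 : 0 < rho / 2 by lra.
have z0 : normc (0 : R[i]) < rho / 2 by rewrite normc_0.
have ex := cauchy_expansion rr hphi.
have bB t : 0 <= t <= 2 * pi -> normc (phi (circle_pt (rho / 2) t)) <= M.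
  by move=> _; apply: bM; rewrite (circle_pt_norm z0); lra.
set c := taylor_coef phi (rho / 2) in ex.
have bc m : normc (c m) * (rho / 2) ^+ m <= 2 * M := taylor_coef_bound m rr hphi bB.
have M20 : 0 <= 2 * M by rewrite mulr_ge0.
have tail n z : normc z <= rho / 4 ->
    normc (phi z - psum c z n) <= 4 * M * (normc z / (rho / 2)) ^+ n.
  move=> zr; rewrite (_ : 4 * M = 2 * (2 * M)); last by ring.
  by apply: expands_tail ex r0 M20 bc _ _; lra.
have c0 : c 0%N = phi 0.
  apply: eqc_norm0 => e e0; rewrite normc_distC.
  have := tail 1%N 0; rewrite normc_0 /psum big_ord1 expr0 mulr1 mul0r expr1 mulr0.
  by move=> h; rewrite (le_trans (h _)) ?(ltW e0)//; lra.
have quad z : normc z <= rho / 4 ->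
    normc (phi z - phi 0 - c 1%N * z) <= 16 * M / rho ^+ 2 * normc z ^+ 2.
  move=> /(tail 2%N); rewrite /psum !big_ord_recl big_ord0 /= expr0 expr1 addr0 mulr1 c0.
  rewrite opprD addrA; congr (_ <= _).
  by field; rewrite gt_eqF.
suff lE : l = c 1%N.
  rewrite lE; split=> //; have := bc 1%N; rewrite expr1.
  rewrite ler_pdivlMr//; move: (normc _) => y; lra.
apply: eqc_norm0 => e e0.
set C := 16 * M / rho ^+ 2 in quad.
have C0 : 0 <= C by apply: divr_ge0; [rewrite mulr_ge0|exact: exprn_ge0 (ltW rho0)].
have e20 : 0 < e / 2 by lra.
have [d d0 Hd] := dl _ e20.
pose x := Num.min (rho / 4) (Num.min (d / 2) (e / 2 / (C + 1))).
have x0 : 0 < x.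
  by rewrite !lt_min; apply/and3P; split; [lra|lra|rewrite divr_gt0//; lra].
have [x1 x2 x3] : [/\ x <= rho / 4, x <= d / 2 & x <= e / 2 / (C + 1)].
  by rewrite /x; split; rewrite !ge_min lexx ?orbT.
have nx : normc (x%:C : R[i]) = x by rewrite normc_real gtr0_norm.
have := Hd x%:C; rewrite nx add0r => /(_ _) h1.
have {}h1 : normc (phi x%:C - phi 0 - l * x%:C) <= e / 2 * x by apply: h1; lra.
have := quad x%:C; rewrite nx => /(_ x1) h2.
rewrite -(ler_pM2r x0) -{1}nx -normcM.
have -> : (l - c 1%N) * x%:C = (phi x%:C - phi 0 - c 1%N * x%:C)
   - (phi x%:C - phi 0 - l * x%:C) by ring.
rewrite (le_trans (le_normcB _ _))// (le_trans (lerD h2 h1))//.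
rewrite expr2 mulrA -mulrDl ler_wpM2r ?(ltW x0)//.
have : C * x <= e / 2.
  rewrite (@le_trans _ _ ((C + 1) * x))//; first by rewrite ler_wpM2r ?(ltW x0)//; lra.
  by rewrite mulrC -ler_pdivlMr//; lra.
lra.
Qed.

End CauchyExpansion.

(** * Differentiability in several complex variables *)

Lemma differentiable_littleo (K : numFieldType) (V W : normedModType K)
    (g : V -> W) (z : V) :
  (forall e : K, 0 < e -> \forall h \near 0, `|g (h + z) - g z| <= e * `|h|) ->
  differentiable g z.
Proof.
move=> Hg; have c0 : continuous (\0 : V -> W) by move=> x; exact: cvg_cst.
have go : g \o shift z = cst (g z) + \0 +o_ 0 id.
  apply/eqaddoP => e e0; apply: filterS (Hg e e0) => h.
  by rewrite !fctE /= addr0.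
by apply/diff_locallyP; rewrite (@diff_unique _ _ _ g \0 z c0 go).
Qed.

Section VectorDerivative.
Variables (R : realType) (n : nat).
Implicit Types (f g : 'rV[R[i]]_n -> R[i]) (z h w : 'rV[R[i]]_n) (s : R).

(** Bounds on vectors are stated with real numbers, the norm of a complex row
    vector being itself a complex number. *)
Definition coords_le h s : Prop := forall i, normc (h ord0 i) <= s.

Lemma coords_leP h s : 0 <= s -> coords_le h s <-> `|h| <= s%:C.
Proof.
move=> s0; split=> [hs|hs i].
  have [h0|/mx_norm_neq0[[j i] /= hE]] := eqVneq (mx_norm h) 0.
    by rewrite /Num.norm/= h0 ler0c.
  by rewrite /Num.norm/= hE [j]ord1 normc_norm lecR; exact: hs.
rewrite -lecR -normc_norm (le_trans _ hs)// -[ `|h| ]/(mx_norm h) mx_normE.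
by rewrite -[leLHS]nngE num_le; exact: (le_bigmax _ _ (ord0, i)).
Qed.

Lemma norm_rV_real h : `|h| = (complex.Re `|h|)%:C.
Proof. by rewrite RRe_real// normr_real. Qed.

Lemma coords_le_norm h : coords_le h (complex.Re `|h|).
Proof.
have h0 : 0 <= complex.Re `|h| by rewrite -ler0c -norm_rV_real.
by apply/(coords_leP _ h0); rewrite -norm_rV_real.
Qed.

Lemma differentiable_eps f z : differentiable f z ->
  forall e, 0 < e -> exists2 d, 0 < d & forall h s, s < d -> coords_le h s -> 0 <= s ->
    normc (f (z + h) - f z - 'd f z h) <= e * s.
Proof.
move=> df e e0; have := diff_locally df => /eqaddoP.
have e0' : 0 < e%:C by rewrite ltcR.
move=> /(_ _ e0') /nbhs_ballP[d /= d0 Hd].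
have dE : d = (complex.Re d)%:C by rewrite RRe_real// gtr0_real.
exists (complex.Re d); first by rewrite -ltcR -dE.
move=> h s sd hs s0.
have hs' : `|h| <= s%:C by apply/coords_leP.
have := Hd h; rewrite -ball_normE/= sub0r normrN => /(_ _) h1.
have {}h1 := h1 (le_lt_trans hs' _); move: h1; rewrite dE ltcR => /(_ sd).
rewrite !fctE /= => h1.
rewrite -lecR -normc_norm rmorphM.
rewrite (_ : _ - _ - _ = f (h + z) - (f z + 'd f z h)); last first.
  by rewrite [h + z]addrC opprD addrA.
apply: le_trans h1 _.
by rewrite ler_wpM2l// ltW.
Qed.

Lemma differentiable_linear_form (l : 'I_n -> R[i]) z :
  differentiable (fun w : 'rV[R[i]]_n => \sum_(i < n) w ord0 i * l i) z.
Proof.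
have -> : (fun w : 'rV[R[i]]_n => \sum_(i < n) w ord0 i * l i) =
    \sum_(i < n) (fun w : 'rV[R[i]]_n => w ord0 i * l i).
  by apply/funext => w; rewrite fct_sumE.
apply: differentiable_sum => i; apply: differentiableM.
  exact: differentiable_coord.
exact: differentiable_cst.
Qed.

(** How differentiability is established below: a candidate gradient with a
    quadratic error. *)
Lemma differentiable_quadratic f z (l : 'I_n -> R[i]) (C d : R) : 0 < d ->
  (forall h s, 0 < s <= d -> coords_le h s ->
    normc (f (z + h) - f z - \sum_(i < n) h ord0 i * l i) <= C * s ^+ 2) ->
  differentiable f z.
Proof.
move=> d0 Hd; pose L (w : 'rV[R[i]]_n) : R[i] := \sum_(i < n) w ord0 i * l i.
pose g (w : 'rV[R[i]]_n) : R[i] := f w - L w.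
have LD w h : L (w + h) = L w + L h.
  by rewrite /L -big_split; apply: eq_bigr => i _; rewrite mxE mulrDl.
have gd : differentiable g z.
  apply: differentiable_littleo => e e0.
  have eE : e = (complex.Re e)%:C by rewrite RRe_real// gtr0_real.
  set e' := complex.Re e in eE.
  have e'0 : 0 < e' by rewrite -ltcR -eE.
  pose k := Num.min d (e' / (`|C| + 1)).
  have C0 : 0 < `|C| + 1 by rewrite ltr_wpDl.
  have k0 : 0 < k by rewrite lt_min d0 divr_gt0.
  apply/nbhs_ballP; exists k%:C => /=; first by rewrite ltcR.
  move=> h; rewrite -ball_normE/= sub0r normrN => hk.
  have [->|hn0] := eqVneq h 0; first by rewrite add0r subrr !normr0 mulr0.
  set s := complex.Re `|h|.
  have hE : `|h| = s%:C := norm_rV_real h.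
  have s0 : 0 < s by rewrite -ltcR -hE normr_gt0.
  have sk : s < k by rewrite -ltcR -hE.
  have [sd se] : s <= d /\ s <= e' / (`|C| + 1).
    by move: (ltW sk); rewrite le_min => /andP.
  rewrite hE eE normc_norm -rmorphM lecR.
  rewrite (_ : _ - _ = f (z + h) - f z - L h); last first.
    by rewrite /g [h + z]addrC LD; ring.
  rewrite (le_trans (Hd h s _ (coords_le_norm h))) ?s0//.
  rewrite expr2 mulrA ler_wpM2r ?(ltW s0)//.
  rewrite (@le_trans _ _ ((`|C| + 1) * s))//.
    by rewrite ler_wpM2r ?(ltW s0)// (le_trans (ler_norm C))// lerDl.
  by rewrite mulrC -ler_pdivlMr.
have -> : f = g + L by apply/funext => w; rewrite fctE /g subrK.
by apply: differentiableD => //; exact: differentiable_linear_form.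
Qed.

End VectorDerivative.

(** * Partial derivatives of holomorphic functions *)

Section Holomorphic.
Variables (R : realType) (n : nat).
Implicit Types (f g : 'rV[R[i]]_n -> R[i]) (z h w : 'rV[R[i]]_n) (s : R).

(** Restriction to a complex line, through which the theory of one variable is
    applied. *)
Lemma slice_cdiff f w h (x : R[i]) : differentiable f (w + x *: h) ->
  cdiff (fun y => f (w + y *: h)) x ('d f (w + x *: h) h).
Proof.
move=> df e e0.
pose S := complex.Re `|h| + 1.
have hS : 0 <= complex.Re `|h| by rewrite -ler0c -norm_rV_real.
have S0 : 0 < S by rewrite /S; lra.
have [d d0 Hd] := differentiable_eps df (divr_gt0 e0 S0).
exists (d / S); first by rewrite divr_gt0.
move=> y yd; have := Hd (y *: h) (normc y * S).
rewrite -ltr_pdivlMr// => /(_ yd) h1.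
rewrite scalerDl addrA linearZ /= in h1 *.
rewrite mulrC (_ : e * _ = e / S * (normc y * S)); last first.
  by field; rewrite gt_eqF.
apply: h1; last by rewrite mulr_ge0 ?normc_ge0 ?ltW.
move=> i; rewrite mxE normcM ler_wpM2l ?normc_ge0//.
by rewrite (le_trans (coords_le_norm h i))// /S lerDl.
Qed.

Lemma coords_le_delta (j : 'I_n) (a : R[i]) :
  coords_le (a *: (delta_mx ord0 j : 'rV[R[i]]_n)) (normc a).
Proof.
move=> i; rewrite !mxE eqxx /=; case: eqP => _.
  by rewrite mulr1.
by rewrite mulr0 normc_0 normc_ge0.
Qed.

Lemma coords_leD h w s t : coords_le h s -> coords_le w t -> coords_le (h + w) (s + t).
Proof. by move=> hs wt i; rewrite mxE (le_trans (le_normcD _ _))// lerD. Qed.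

Lemma coords_le_trans h s t : s <= t -> coords_le h s -> coords_le h t.
Proof. by move=> st hs i; rewrite (le_trans (hs i)). Qed.

Lemma coords_leZ (a : R[i]) h s : coords_le h s -> coords_le (a *: h) (normc a * s).
Proof. by move=> hs i; rewrite mxE normcM ler_wpM2l ?normc_ge0. Qed.

Section LocalEstimates.
Variables (f : 'rV[R[i]]_n -> R[i]) (z0 : 'rV[R[i]]_n) (d M : R).
Hypotheses (d0 : 0 < d) (fd : forall h, coords_le h d -> differentiable f (z0 + h))
  (fM : forall h, coords_le h d -> normc (f (z0 + h)) <= M).

(** The constant depends neither on the base point nor on the direction: this
    uniformity is what makes the partial derivatives differentiable. *)
Lemma taylor_first_order k h s : coords_le k (d / 2) -> 0 < s <= d / 8 ->
  coords_le h s ->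
  normc (f (z0 + k + h) - f (z0 + k) - 'd f (z0 + k) h)
    <= 16 * M / (d / 2) ^+ 2 * s ^+ 2.
Proof.
move=> kd /andP[s0 sd] hs; have d0' := d0.
pose v := (s%:C)^-1 *: h.
have sC : (s%:C : R[i]) != 0 by rewrite -normc_gt0 normc_real gtr0_norm.
have hv : h = s%:C *: v by rewrite /v scalerA mulfV// scale1r.
have v1 : coords_le v 1.
  have := coords_leZ (s%:C)^-1 hs; rewrite normcV normc_real gtr0_norm// mulVf//.
  by rewrite gt_eqF.
clearbody v.
have inb y : normc y < d / 2 -> coords_le (k + y *: v) d.
  move=> yd; apply: coords_le_trans (coords_leD kd (coords_leZ y v1)).
  by rewrite mulr1; lra.
pose phi y := f (z0 + k + y *: v).
have d20 : 0 < d / 2 by lra.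
have dphi y : normc y < d / 2 -> cdiff phi y ('d f (z0 + k + y *: v) v).
  by move=> /inb yd; apply: slice_cdiff; rewrite -addrA; exact: fd.
have [|y yd||_] := @cauchy_estimate _ phi (d / 2) M ('d f (z0 + k) v) d20.
- by move=> y /dphi; exists ('d f (z0 + k + y *: v) v).
- by rewrite /phi -addrA; apply/fM/inb.
- by have := dphi 0; rewrite normc_0 scale0r addr0 => /(_ d20).
move=> /(_ s%:C); rewrite normc_real gtr0_norm// /phi scale0r addr0.
have -> : 'd f (z0 + k) v * s%:C = 'd f (z0 + k) h by rewrite hv linearZ mulrC.
by rewrite -hv; apply; lra.
Qed.

(** The second partial derivatives enter through this estimate: applying
    Cauchy's estimate in the direction of the i-th axis to a combination of
    increments of f whose linear parts cancel bounds the same combination of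
    increments of the i-th partial derivative.  The sequence r lists triples
    (coefficient, increment, bound on the increment). *)
Lemma partial_increment (i : 'I_n) (r : seq (R[i] * 'rV[R[i]]_n * R)) :
  let D w := 'd f w (delta_mx ord0 i) in
  (forall p, p \in r -> 0 < p.2 <= d / 8 /\ coords_le p.1.2 p.2) ->
  \sum_(p <- r) p.1.1 *: p.1.2 = 0 ->
  normc (\sum_(p <- r) p.1.1 * (D (z0 + p.1.2) - D z0)) <=
    4 * (16 * M / (d / 2) ^+ 2 * \sum_(p <- r) normc p.1.1 * p.2 ^+ 2) / (d / 4).
Proof.
move=> D hr hsum; set e := delta_mx ord0 i : 'rV[R[i]]_n; have d0' := d0.
have e1 (y : R[i]) : coords_le (y *: e) (normc y) by exact: coords_le_delta.
pose E h (y : R[i]) := f (z0 + h + y *: e) + -1 * f (z0 + 0 + y *: e).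
have dE h y : coords_le h (d / 8) -> normc y < d / 4 ->
    cdiff (E h) y ('d f (z0 + h + y *: e) e + -1 * 'd f (z0 + 0 + y *: e) e).
  move=> hd yd; apply: cdiffD; last apply: cdiffMl.
    apply: slice_cdiff; rewrite -addrA; apply: fd.
    by apply: coords_le_trans (coords_leD hd (e1 y)); lra.
  apply: slice_cdiff; rewrite addr0; apply: fd.
  by apply: coords_le_trans (e1 y); lra.
pose chi y := \sum_(p <- r) (if p \in r then p.1.1 * E p.1.2 y else 0).
have dchi y : normc y < d / 4 -> cdiff chi y (\sum_(p <- r) (if p \in r then
    p.1.1 * ('d f (z0 + p.1.2 + y *: e) e + -1 * 'd f (z0 + 0 + y *: e) e) else 0)).
  move=> yd; apply: cdiff_sum => p; case: ifP => [pr|_]; last exact: cdiff_cst.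
  have [/andP[_ p2] p1] := hr p pr.
  by apply/cdiffMl/dE => //; exact: coords_le_trans p1.
have d40 : 0 < d / 4 by lra.
have [|y yd||] := @cauchy_estimate _ chi (d / 4)
    (16 * M / (d / 2) ^+ 2 * \sum_(p <- r) normc p.1.1 * p.2 ^+ 2)
    (\sum_(p <- r) p.1.1 * (D (z0 + p.1.2) - D z0)) d40.
- by move=> y /dchi; eexists; eassumption.
- have yE : coords_le (y *: e) (d / 2) by apply: coords_le_trans (e1 y); lra.
  have -> : chi y = \sum_(p <- r) (p.1.1 * (E p.1.2 y - 'd f (z0 + y *: e) p.1.2)).
    have /eqP := congr1 ('d f (z0 + y *: e)) hsum.
    rewrite linear0 linear_sum /= => /eqP lin0.
    rewrite (_ : chi y = chi y - \sum_(p <- r) 'd f (z0 + y *: e) (p.1.1 *: p.1.2)); last first.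
      by rewrite lin0 subr0.
    rewrite /chi -sumrB big_seq [RHS]big_seq; apply: eq_bigr => p pr.
    by rewrite pr linearZ mulrBr.
  rewrite (le_trans (normc_sum _ _ _))// mulr_sumr big_seq [leRHS]big_seq.
  apply: ler_sum => p pr; have [p2 p1] := hr p pr.
  rewrite normcM mulrCA ler_wpM2l ?normc_ge0//.
  rewrite (_ : _ - _ = f (z0 + y *: e + p.1.2) - f (z0 + y *: e) - 'd f (z0 + y *: e) p.1.2).
    exact: taylor_first_order.
  by rewrite /E addr0 mulN1r [z0 + y *: e + _]addrAC.
- have := dchi 0; rewrite normc_0 => /(_ d40).
  rewrite big_seq [in X in _ -> X]big_seq; congr cdiff.
  by apply: eq_bigr => p ->; rewrite scale0r !addr0 mulN1r.
- by move=> + _.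
Qed.

End LocalEstimates.

Lemma dyadic_limit (u : nat -> R) (K : R) :
  (forall m, `|u m.+1 - u m| <= K / 2 ^+ m.+1) ->
  exists x, forall m, `|u m - x| <= K / 2 ^+ m.
Proof.
move=> hu; have K0 : 0 <= K.
  have := le_trans (normr_ge0 _) (hu 0%N).
  by rewrite pmulr_lge0// invr_gt0 exprn_gt0.
have hE m : K / 2 ^+ m = 2 * (K / 2 ^+ m.+1).
  by rewrite exprS; field; rewrite expf_neq0.
have [||x hx] := @nested_intervals _ (fun m => u m - K / 2 ^+ m) (2 * K).
- by rewrite mulr_ge0.
- move=> m; have := hu m; rewrite ler_norml (hE m) -mulrA.
  by move: (K / 2 ^+ m.+1) => y; lra.
exists x => m; have := hx m; rewrite ler_norml -mulrA.
by move: (K / 2 ^+ m) => y; lra.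
Qed.

Lemma complex_dyadic_limit (u : nat -> R[i]) (K : R) :
  (forall m, normc (u m.+1 - u m) <= K / 2 ^+ m.+1) ->
  exists x, forall m, normc (u m - x) <= 2 * K / 2 ^+ m.
Proof.
move=> hu.
have [|a ha] := @dyadic_limit (fun m => complex.Re (u m)) K.
  by move=> m; rewrite -ReN -ReD (le_trans (Re_le_normc _)).
have [|b hb] := @dyadic_limit (fun m => complex.Im (u m)) K.
  by move=> m; rewrite -ImN -ImD (le_trans (Im_le_normc _)).
exists (a +i* b) => m; rewrite (le_trans (normc_le_ReIm _))//.
rewrite (_ : 2 * K / 2 ^+ m = K / 2 ^+ m + K / 2 ^+ m); last by ring.
by rewrite ReD ReN ImD ImN /= lerD.
Qed.

(** The difference quotients of the partial derivative along each axis converge,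
    with error linear in the step, because two of them form a combination whose
    linear part cancels.  Comparing an arbitrary increment with increments along
    the axes then gives a quadratic error. *)
Lemma partial_differentiable f z0 (d M : R) i : 0 < d ->
  (forall h, coords_le h d -> differentiable f (z0 + h)) ->
  (forall h, coords_le h d -> normc (f (z0 + h)) <= M) ->
  differentiable (fun z => 'D_(delta_mx ord0 i) f z) z0.
Proof.
move=> d0 fd fM.
pose D w := 'd f w (delta_mx ord0 i).
pose K := 4 * (16 * M / (d / 2) ^+ 2) / (d / 4).
have inc (r : seq (R[i] * 'rV[R[i]]_n * R)) :
   (forall p, p \in r -> 0 < p.2 <= d / 8 /\ coords_le p.1.2 p.2) ->
   \sum_(p <- r) p.1.1 *: p.1.2 = 0 ->
   normc (\sum_(p <- r) p.1.1 * (D (z0 + p.1.2) - D z0)) <=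
    K * \sum_(p <- r) normc p.1.1 * p.2 ^+ 2.
  move=> h1 h2; have := partial_increment d0 fd fM i h1 h2.
  rewrite -/D; move=> /le_trans; apply; rewrite /K.
  by move: (\sum_(p <- r) _) => y; rewrite le_eqVlt; apply/orP; left; apply/eqP; ring.
pose q j (s : R) := (s%:C)^-1 * (D (z0 + s%:C *: delta_mx ord0 j) - D z0).
have qd j s t : 0 < s <= d / 8 -> 0 < t <= d / 8 -> normc (q j s - q j t) <= K * (s + t).
  move=> hs ht; have /andP[s0 _] := hs; have /andP[t0 _] := ht.
  have sC : (s%:C : R[i]) != 0 by rewrite -normc_gt0 normc_real gtr0_norm.
  have tC : (t%:C : R[i]) != 0 by rewrite -normc_gt0 normc_real gtr0_norm.
  have st : (t^-1 * t ^+ 2 = t) * (s^-1 * s ^+ 2 = s).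
    by split; rewrite expr2 mulKf// gt_eqF.
  have e1 : normc (s%:C)^-1 = s^-1 by rewrite normcV normc_real gtr0_norm.
  have e2 : normc (- (t%:C)^-1) = t^-1 by rewrite normcN normcV normc_real gtr0_norm.
  have sum2 (V : nmodType) (T : Type) (F : T -> V) a b : \sum_(p <- [:: a; b]) F p = F a + F b.
    by rewrite !big_cons big_nil addr0.
  have := inc [:: ((s%:C)^-1, s%:C *: delta_mx ord0 j, s);
     (- (t%:C)^-1, t%:C *: delta_mx ord0 j, t)].
  rewrite !sum2 => inc2.
  have {}inc2 : normc (q j s + - (t%:C)^-1 * (D (z0 + t%:C *: delta_mx ord0 j) - D z0))
      <= K * (normc (s%:C)^-1 * s ^+ 2 + normc (- (t%:C)^-1) * t ^+ 2).
    apply: inc2.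
      move=> p; rewrite !inE => /orP[] /eqP -> ; split=> // k.
        by have := coords_le_delta j s%:C k; rewrite normc_real gtr0_norm.
      by have := coords_le_delta j t%:C k; rewrite normc_real gtr0_norm.
    rewrite -[LHS]/((s%:C)^-1 *: (s%:C *: delta_mx ord0 j) +
      - (t%:C)^-1 *: (t%:C *: delta_mx ord0 j)).
    by rewrite !scalerA mulVf// mulNr mulVf// scaleN1r scale1r subrr.
  by rewrite mulNr e1 e2 !st in inc2.
have K0 : 0 <= K.
  have M0 : 0 <= M.
    by apply: le_trans (normc_ge0 _) (fM 0 _) => k; rewrite mxE normc_0 ltW.
  have d2 : 0 <= d / 2 by lra.
  have d4 : 0 <= d / 4 by lra.
  exact: divr_ge0 (mulr_ge0 (ler0n _ 4) (divr_ge0 (mulr_ge0 (ler0n _ 16) M0) (exprn_ge0 2 d2))) d4.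
have /choice[l hl] (j : 'I_n) : exists l, forall s, 0 < s <= d / 8 ->
    normc (q j s - l) <= K * s.
  (* The limit is found along dyadic steps; qd extends it to all steps. *)
  pose u m := q j (d / 8 / 2 ^+ m).
  have um m : 0 < d / 8 / 2 ^+ m <= d / 8.
    rewrite divr_gt0 ?exprn_gt0//=; last by lra.
    by rewrite ler_piMr// ?invf_le1 ?exprn_gt0// ?exprn_ege1 ?ler1n//; lra.
  have [|x hx] := @complex_dyadic_limit u (K * (3 * d / 8)).
    move=> m; rewrite (le_trans (qd j _ _ (um _) (um _)))//.
    have kE (k y : R) : y != 0 -> k * (d / 8 / (2 * y) + d / 8 / y) = k * (3 * d / 8) / (2 * y).
      by move=> y0; field.
    by rewrite exprS kE// expf_neq0.
  exists x => s hs; apply/ler_addgt0Pr => e e0.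
  have q01 : 0 <= (2^-1 : R) < 1 by lra.
  have [N HN] := geometric_small (K * (d / 8) + 2 * (K * (3 * d / 8))) q01 e0.
  have := HN N (leqnn N); rewrite exprVn => {}HN.
  rewrite (le_trans (normc_triangle _ (u N) _))//.
  rewrite (le_trans (lerD (qd j s _ hs (um N)) (hx N)))//.
  by move: HN; rewrite mulrDr !mulrDl !mulrA; lra.
have d8 : 0 < d / 8 by lra.
apply: (@differentiable_quadratic _ _ _ _ l (K * (1 + n%:R) + n%:R * K) (d / 8) d8).
move=> h s hs hc; have /andP[s0 sd] := hs.
have hd : coords_le h d by apply: coords_le_trans hc; lra.
have z0d : coords_le (0 : 'rV[R[i]]_n) d by move=> k; rewrite mxE normc_0 ltW.
have -> : 'D_(delta_mx ord0 i) f (z0 + h) = D (z0 + h) by rewrite deriveE//; exact: fd.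
have -> : 'D_(delta_mx ord0 i) f z0 = D z0.
  by rewrite deriveE// -[z0]addr0; exact: fd.
have sC : (s%:C : R[i]) != 0 by rewrite -normc_gt0 normc_real gtr0_norm.
have := inc ((1, h, s) ::
  [seq (- h ord0 j / s%:C, s%:C *: delta_mx ord0 j, s) | j <- index_enum 'I_n]).
rewrite !big_cons !big_map => h1.
have hql : \sum_(j < n) h ord0 j * (q j s - l j) =
    \sum_(j < n) h ord0 j * q j s - \sum_(j < n) h ord0 j * l j.
  by rewrite -sumrB; apply: eq_bigr => j _; rewrite mulrBr.
rewrite [X in normc X](_ : _ = (D (z0 + h) - D z0 - \sum_(j < n) h ord0 j * q j s)
   + \sum_(j < n) h ord0 j * (q j s - l j)); last by rewrite hql addrA subrK.
rewrite (le_trans (le_normcD _ _))// mulrDl lerD//.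
  rewrite (_ : _ - \sum_(j < n) _ = 1 * (D (z0 + h) - D z0) + \sum_(j < n)
     - h ord0 j / s%:C * (D (z0 + s%:C *: delta_mx ord0 j) - D z0)); last first.
    rewrite mul1r -sumrN; congr (_ + _); apply: eq_bigr => j _.
    by rewrite /q !mulNr mulrA.
  apply: (le_trans (h1 _ _)).
  - move=> p; rewrite inE => /orP[/eqP ->//|/mapP[j _ ->]]; split=> // k.
    by have := coords_le_delta j s%:C k; rewrite normc_real gtr0_norm.
  - rewrite -[LHS]/(1 *: h + \sum_(j < n) (- h ord0 j / s%:C) *: (s%:C *: delta_mx ord0 j)).
    rewrite scale1r [X in _ + X](_ : _ = - h) ?subrr// [in RHS](row_sum_delta h).
    rewrite -sumrN; apply: eq_bigr => j _.
    by rewrite scalerA divfK// scaleNr.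
  rewrite -[X in K * X]/(normc 1 * s ^+ 2 + \sum_(j < n) normc (- h ord0 j / s%:C) * s ^+ 2).
  rewrite normc_1 mul1r -mulrA ler_wpM2l// mulrDl mul1r lerD2l.
  rewrite (@le_trans _ _ (\sum_(j < n) s ^+ 2))//; last first.
    by rewrite sumr_const card_ord mulr_natl.
  apply: ler_sum => j _; rewrite ler_piMl ?exprn_ge0 ?(ltW s0)//.
  rewrite mulNr normcN normcM normcV normc_real gtr0_norm// ler_pdivrMr// mul1r.
  exact: hc.
rewrite (le_trans (normc_sum _ _ _))//.
rewrite (@le_trans _ _ (\sum_(j < n) s * (K * s)))//; last first.
  by rewrite sumr_const card_ord -mulr_natl le_eqVlt; apply/orP; left; apply/eqP; ring.
apply: ler_sum => j _; rewrite normcM ler_pM ?normc_ge0//.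
exact: hl.
Qed.

End Holomorphic.

(** * Holomorphic functions on the unit ball and their slices *)

Section UnitBall.
Variables (R : realType) (n : nat).
Implicit Types (f g : 'rV[R[i]]_n -> R[i]) (z h w : 'rV[R[i]]_n).

Lemma euclid_norm_ge0 z : 0 <= euclid_norm z.
Proof. exact: sqrtr_ge0. Qed.

Lemma unit_ballE z : unit_ball z <-> \sum_(i < n) normc (z ord0 i) ^+ 2 < 1.
Proof.
rewrite /unit_ball /= /euclid_norm -{1}[1]sqrtr1 ltr_sqrt//.
Qed.

Lemma euclid_normZ (a : R[i]) z : euclid_norm (a *: z) = normc a * euclid_norm z.
Proof.
rewrite /euclid_norm (eq_bigr (fun i => normc a ^+ 2 * normc (z ord0 i) ^+ 2)).
  by rewrite -mulr_sumr sqrtrM ?sqr_ge0// sqrtr_sqr ger0_norm ?normc_ge0.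
by move=> i _; rewrite mxE normcM exprMn.
Qed.

(** With all coordinates of z at most 1 in modulus, moving each of them by at
    most d <= 1 changes the squared norm by at most 3 n d. *)
Lemma unit_ball_open z : unit_ball z ->
  exists2 d, 0 < d & forall h, coords_le h d -> unit_ball (z + h).
Proof.
move=> /unit_ballE; set S := \sum_(i < n) _ => S1.
have z1 i : normc (z ord0 i) <= 1.
  rewrite -(@ler_pXn2r _ 2) ?nnegrE ?normc_ge0// expr1n.
  apply: le_trans (ltW S1); rewrite /S (bigD1 i)//= lerDl.
  by apply: sumr_ge0 => j _; rewrite sqr_ge0.
pose d := Num.min 1 ((1 - S) / (3 * n%:R + 1)).
have n0 : 0 < 3 * n%:R + 1 :> R by rewrite ltr_wpDl// mulr_ge0.
have d0 : 0 < d by rewrite lt_min ltr01 divr_gt0// subr_gt0.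
have d1 : d <= 1 by rewrite ge_min lexx.
exists d => // h hd; apply/unit_ballE.
have : \sum_(i < n) normc ((z + h) ord0 i) ^+ 2 <= S + 3 * n%:R * d.
  rewrite (@le_trans _ _ (\sum_(i < n) (normc (z ord0 i) ^+ 2 + 3 * d)))//.
    apply: ler_sum => i _; rewrite mxE.
    rewrite (@le_trans _ _ ((normc (z ord0 i) + d) ^+ 2))//.
      apply: lerXn2r; rewrite ?nnegrE ?normc_ge0//.
        by rewrite addr_ge0 ?normc_ge0// ltW.
      by rewrite (le_trans (le_normcD _ _))// lerD2l.
    have := z1 i; have := normc_ge0 (z ord0 i).
    by move: (normc _) => x x0 x1; nra.
  rewrite big_split /= sumr_const card_ord -/S lerD2l -mulr_natl.
  by rewrite le_eqVlt; apply/orP; left; apply/eqP; ring.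
move=> /le_lt_trans; apply; rewrite -ltrBrDl.
have : (3 * n%:R + 1) * d <= 1 - S by rewrite mulrC -ler_pdivlMr// ge_min lexx orbT.
lra.
Qed.

Lemma diff_row f z h :
  'd f z h = \sum_(j < n) h ord0 j * 'd f z (delta_mx ord0 j).
Proof.
rewrite {1}(row_sum_delta h) linear_sum; apply: eq_bigr => j _.
exact: linearZ.
Qed.

Lemma differentiable_locally_bounded f z : differentiable f z ->
  exists d M, 0 < d /\ forall h, coords_le h d -> normc (f (z + h)) <= M.
Proof.
move=> df; have [d d0 Hd] := differentiable_eps df ltr01.
pose S := \sum_(j < n) normc ('d f z (delta_mx ord0 j)).
exists (d / 2), (normc (f z) + d / 2 * S + d / 2); split; first by rewrite divr_gt0.
move=> h hd; have d2 : d / 2 < d by lra.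
have := Hd h (d / 2) d2 hd; rewrite mul1r => /(_ _) h1.
have {}h1 : normc (f (z + h) - f z - 'd f z h) <= d / 2 by apply: h1; lra.
rewrite (_ : f (z + h) = f z + 'd f z h + (f (z + h) - f z - 'd f z h)); last by ring.
rewrite (le_trans (le_normcD _ _))// lerD// (le_trans (le_normcD _ _))// lerD2l.
rewrite diff_row (le_trans (normc_sum _ _ _))//.
rewrite /S mulr_sumr; apply: ler_sum => j _.
by rewrite normcM ler_wpM2r ?normc_ge0.
Qed.

Lemma Hol_radial f : Hol f -> Hol (radial f).
Proof.
move=> hf z zb.
have [d1 d10 H1] := unit_ball_open zb.
have [d2 [M [d20 H2]]] := differentiable_locally_bounded (hf z zb).
pose d := Num.min d1 d2; have d0 : 0 < d by rewrite lt_min d10.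
have -> : radial f = \sum_(i < n) (fun w : 'rV[R[i]]_n =>
    w ord0 i * 'D_(delta_mx ord0 i) f w).
  by apply/funext => w; rewrite fct_sumE.
apply: differentiable_sum => i; apply: differentiableM.
  exact: differentiable_coord.
apply: (partial_differentiable (M := M) i d0) => h hd.
  apply: hf; apply: H1; apply: coords_le_trans hd; first by rewrite ge_min lexx.
apply: H2; apply: coords_le_trans hd; first by rewrite ge_min lexx orbT.
Qed.

Lemma Hol_iter_radial f j : Hol f -> Hol (iter j (@radial R n) f).
Proof. by move=> hf; elim: j => //= j; exact: Hol_radial. Qed.

Lemma HolD f g : Hol f -> Hol g -> Hol (fun z => f z + g z).
Proof. by move=> hf hg z zb; apply: differentiableD; [exact: hf|exact: hg]. Qed.

Lemma HolMl (a : R[i]) f : Hol f -> Hol (fun z => a * f z).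
Proof.
move=> hf z zb; apply: differentiableM; last exact: hf.
exact: differentiable_cst.
Qed.

Lemma Hol_sum (I : Type) (r : seq I) (F : I -> 'rV[R[i]]_n -> R[i]) :
  (forall j, Hol (F j)) -> Hol (fun z => \sum_(j <- r) F j z).
Proof.
move=> hF; elim: r => [|j r IH].
  by under eq_fun do rewrite big_nil; move=> z _; exact: differentiable_cst.
by under eq_fun do rewrite big_cons; exact: (HolD (hF j) IH).
Qed.

(** A disc larger than the unit one, so that y = 1 is an interior point of the
    slice and series converge there with room to spare. *)
Lemma unit_ball_dilate z : unit_ball z ->
  exists2 rho : R, 1 < rho & forall y : R[i], normc y < rho -> unit_ball (y *: z).
Proof.
rewrite /unit_ball /= => z1; have N0 := euclid_norm_ge0 z.
exists (2 / (1 + euclid_norm z)); first by rewrite ltr_pdivlMr; lra.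
move=> y; rewrite ltr_pdivlMr /= ?euclid_normZ; last by lra.
have := normc_ge0 y; move: (normc y) (euclid_norm z) z1 N0 => a N z1 N0 a0; nra.
Qed.

(** The radial derivative is the derivative along the complex line through 0. *)
Lemma radialE f z : differentiable f z -> radial f z = 'd f z z.
Proof.
move=> df; rewrite diff_row; apply: eq_bigr => i _; rewrite deriveE//.
Qed.

End UnitBall.

Section Expansions.
Variable R : realType.
Implicit Types (phi psi : R[i] -> R[i]) (c d : nat -> R[i]).

Lemma expandsD phi psi r c d : expands phi r c -> expands psi r d ->
  expands (fun z => phi z + psi z) r (fun m => c m + d m).
Proof.
move=> hc hd z zr; have := ctendsD (hc z zr) (hd z zr); congr ctends.
by apply/funext => k; rewrite /psum -big_split; apply: eq_bigr => m _; rewrite mulrDl.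
Qed.

Lemma expandsMl phi r c a : expands phi r c ->
  expands (fun z => a * phi z) r (fun m => a * c m).
Proof.
move=> hc z zr; have := ctendsMl a (hc z zr); congr ctends.
by apply/funext => k; rewrite /psum mulr_sumr; apply: eq_bigr => m _; rewrite mulrA.
Qed.

Lemma expands_sum (I : Type) (s : seq I) (phi : I -> R[i] -> R[i]) r
    (c : I -> nat -> R[i]) : (forall j, expands (phi j) r (c j)) ->
  expands (fun z => \sum_(j <- s) phi j z) r (fun m => \sum_(j <- s) c j m).
Proof.
move=> hc; elim: s => [|j s IH].
  under eq_fun do rewrite big_nil; under [fun m => _]eq_fun do rewrite big_nil.
  move=> z _; apply: (@ctends_eventually _ (fun=> 0) _ _ 0%N) => [k _|]; last exact: ctends_cst.
  by rewrite /psum big1// => m _; rewrite mul0r.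
under eq_fun do rewrite big_cons; under [fun m => _]eq_fun do rewrite big_cons.
exact: (expandsD (hc j) IH).
Qed.

(** Along the line through z, the radial derivative acts as y d/dy, hence
    multiplies the m-th coefficient by m. *)
Lemma iter_radial_expansion (n : nat) (f : 'rV[R[i]]_n -> R[i]) z :
  Hol f -> unit_ball z ->
  exists r c, 1 < r /\ forall j,
    expands (fun y => iter j (@radial R n) f (y *: z)) r (fun m => m%:R ^+ j * c m).
Proof.
move=> hf zb; have [rho rho1 Hrho] := unit_ball_dilate zb.
pose r := (1 + rho) / 2; have r1 : 1 < r by rewrite /r; lra.
have rr : 0 < r < rho by rewrite /r; apply/andP; split; lra.
pose phi g (y : R[i]) : R[i] := (g : 'rV[R[i]]_n -> R[i]) (y *: z).
have dphi g y : Hol g -> normc y < rho -> cdiff (phi g) y ('d g (y *: z) z).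
  move=> hg yr; have := @slice_cdiff _ _ g 0 z y; rewrite add0r => /(_ (hg _ (Hrho y yr))).
  by rewrite (_ : (fun y => g (0 + y *: z)) = phi g)//; apply/funext => x; rewrite add0r.
have hphi g : Hol g -> holo_on_disc (phi g) rho.
  by move=> hg y yr; exists ('d g (y *: z) z); exact: dphi.
have step g : Hol g -> forall m,
    taylor_coef (phi (radial g)) r m = m%:R * taylor_coef (phi g) r m.
  move=> hg m; pose phi' (y : R[i]) : R[i] := 'd g (y *: z) z.
  have d' y : normc y < rho -> cdiff (phi g) y (phi' y) by exact: dphi.
  have hE y : normc y < rho -> phi (radial g) y = y * phi' y.
    by move=> yr; rewrite /phi radialE ?linearZ//; exact/hg/Hrho.
  have hchi : holo_on_disc (fun y => y * phi' y) rho.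
    move=> y yr; have [l dl] := hphi _ (Hol_radial hg) y yr.
    exists l => e e0; have [d d0 Hd] := dl e e0.
    exists (Num.min d (rho - normc y)); first by rewrite lt_min d0 subr_gt0.
    move=> h; rewrite lt_min => /andP[h1 h2]; have := Hd h h1.
    by rewrite !hE// (le_lt_trans (le_normcD _ _))//; lra.
  rewrite -(taylor_coef_radial rr d' hchi); congr (_ * turn_integral _).
  apply/funext => t; rewrite hE// (@circle_pt_norm _ _ 0) ?normc_0//; last by lra.
  by case/andP: rr.
exists r, (taylor_coef (phi f) r); split=> // j.
rewrite (_ : (fun m => _) = taylor_coef (phi (iter j (@radial R n) f)) r).
  exact: cauchy_expansion rr (hphi _ (Hol_iter_radial j hf)).
apply/funext => m; elim: j => [|j IH]; first by rewrite expr0 mul1r.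
by rewrite exprS -mulrA IH -step//; exact: Hol_iter_radial.
Qed.

End Expansions.

(** * Sums over multi-indices *)

Section HasSum.
Variables (R : realType) (n : nat).
Local Notation mi := (multi_index n).
Implicit Types (u v : mi -> R[i]) (s : R[i]) (A B : {fset mi}) (k : mi).

Lemma fset_sum_eq (V : nmodType) A B (P Q : pred mi) (F : mi -> V) :
  (forall k, (k \in A) && P k = (k \in B) && Q k) ->
  \sum_(k <- A | P k) F k = \sum_(k <- B | Q k) F k.
Proof.
move=> AB; rewrite -big_filter -[RHS]big_filter; apply: perm_big.
apply: uniq_perm; rewrite ?filter_uniq ?fset_uniq// => k.
by rewrite !mem_filter andbC AB andbC.
Qed.

Lemma fset_sum_sub (V : nmodType) A B (F : mi -> V) : (A `<=` B)%fset ->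
  \sum_(k <- B) F k = \sum_(k <- A) F k + \sum_(k <- B | k \notin A) F k.
Proof.
move=> /fsubsetP AB; rewrite (bigID (mem A)) /=; congr (_ + _).
apply: fset_sum_eq => k; rewrite andbT; case: (boolP (k \in A)) => [/AB ->//|_].
by rewrite andbF.
Qed.

(** The box of side M, enumerated through finite functions, provides a finite set
    to filter. *)
Definition deg_lt (M : nat) : {fset mi} :=
  [fset k in [seq ([ffun i => val (g i)] : mi) | g : {ffun 'I_n -> 'I_M}] |
    (mi_deg k < M)%N]%fset.

Lemma coord_le_deg k i : (k i <= mi_deg k)%N.
Proof. by rewrite /mi_deg (bigD1 i)//= leq_addr. Qed.

Lemma in_deg_lt M k : (k \in deg_lt M) = (mi_deg k < M)%N.
Proof.
rewrite /deg_lt !inE /=; apply/andP/idP => [[]//|kM]; split=> //.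
have kiM i : (k i < M)%N by exact: leq_ltn_trans (coord_le_deg k i) kM.
apply/mapP; exists [ffun i => Ordinal (kiM i)]; first by rewrite mem_enum.
by apply/ffunP => i; rewrite !ffunE.
Qed.

Lemma deg_lt_sub M N : (M <= N)%N -> (deg_lt M `<=` deg_lt N)%fset.
Proof.
by move=> MN; apply/fsubsetP => k; rewrite !in_deg_lt => /leq_trans; apply.
Qed.

Lemma deg_lt_cofinal A : exists N, forall M, (N <= M)%N -> (A `<=` deg_lt M)%fset.
Proof.
exists (\max_(k <- A) (mi_deg k).+1)%N => M NM; apply/fsubsetP => k kA.
rewrite in_deg_lt (leq_trans _ NM)//.
by apply: (@leq_bigmax_seq _ _ _ (fun k : mi => (mi_deg k).+1)).
Qed.

Definition degree_part u (m : nat) : R[i] :=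
  \sum_(k <- deg_lt m.+1 | mi_deg k == m) u k.

Lemma deg_lt_sum u M : \sum_(k <- deg_lt M) u k = \sum_(m < M) degree_part u m.
Proof.
elim: M => [|M IH].
  rewrite big_ord0 big_seq big1// => k; by rewrite in_deg_lt.
rewrite big_ord_recr /= -IH (fset_sum_sub _ (deg_lt_sub (leqnSn M))).
congr (_ + _); apply: fset_sum_eq => k; rewrite !in_deg_lt ltnS -leqNgt.
by case: ltngtP.
Qed.

Lemma degree_partM (w : nat -> R[i]) u m :
  degree_part (fun k => w (mi_deg k) * u k) m = w m * degree_part u m.
Proof.
by rewrite /degree_part mulr_sumr; apply: eq_bigr => k /eqP ->.
Qed.

Lemma has_sum_ctends u s : has_sum u s ->
  ctends (fun M => \sum_(k <- deg_lt M) u k) s.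
Proof.
move=> us e e0; have [A HA] := us e e0; have [N HN] := deg_lt_cofinal A.
by exists N => M /HN /HA h; rewrite normc_distC ltW.
Qed.

(** Unconditional convergence is absolute: finite sums off a large finite set
    are bounded, so the sums of positive and of negative parts are bounded. *)
Lemma has_sum_abs_bounded u s : has_sum u s ->
  exists K, forall B, \sum_(k <- B) normc (u k) <= K.
Proof.
move=> us; have [A HA] := us 1 ltr01.
have off B (P : pred mi) : normc (\sum_(k <- B | (k \notin A) && P k) u k) <= 2.
  pose E := (A `|` [fset k in B | (k \notin A) && P k])%fset.
  have AE : (A `<=` E)%fset by apply/fsubsetP => k; rewrite !inE => ->.
  have := fset_sum_sub u AE.
  rewrite (@fset_sum_eq _ E B (fun k => k \notin A) (fun k => (k \notin A) && P k)).
    move=> EE; have -> : \sum_(k <- B | (k \notin A) && P k) u k =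
      (s - \sum_(k <- A) u k) - (s - \sum_(k <- E) u k) by rewrite EE; ring.
    rewrite (le_trans (le_normcB _ _))//.
    have h1 := HA A (fsubset_refl A); have h2 := HA E AE.
    by have := ltW (ltrD h1 h2); rewrite -natr1.
  by move=> k; rewrite !inE; case: (k \in A); case: (k \in B); case: (P k).
have half (p : R[i] -> R) B : (forall x y, p (x + y) = p x + p y) -> p 0 = 0 ->
    (forall x, `|p x| <= normc x) -> \sum_(k <- B | k \notin A) `|p (u k)| <= 4.
  move=> pD p0 pn.
  have psum (P : pred mi) (r : seq mi) : \sum_(k <- r | P k) p (u k) = p (\sum_(k <- r | P k) u k).
    by elim/big_ind2 : _ => // x1 x2 y1 y2 -> ->.
  have -> : 4 = 2 + 2 :> R by ring.
  rewrite (bigID (fun k => 0 <= p (u k)))/= lerD//.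
    rewrite (eq_bigr (fun k => p (u k))) => [|k /andP[_ h]]; last by rewrite ger0_norm.
    by rewrite psum (le_trans (ler_norm _))// (le_trans (pn _)).
  rewrite (eq_bigr (fun k => - p (u k))) => [|k /andP[_ h]]; last first.
    by rewrite ltr0_norm// ltNge.
  rewrite sumrN psum (le_trans (ler_norm _))// normrN (le_trans (pn _))//.
exists (\sum_(k <- A) normc (u k) + (4 + 4)) => B.
rewrite (bigID (mem A)) /= lerD//.
  rewrite (@fset_sum_eq _ B (A `&` B)%fset (mem A) xpredT); last first.
    by move=> k; rewrite !inE andbT andbC.
  rewrite [leRHS](fset_sum_sub _ (fsubsetIl A B)) lerDl.
  by apply: sumr_ge0 => k _; exact: normc_ge0.
rewrite (@le_trans _ _ (\sum_(k <- B | k \notin A)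
    (`|complex.Re (u k)| + `|complex.Im (u k)|)))//.
  by apply: ler_sum => k _; exact: normc_le_ReIm.
rewrite big_split lerD//.
  by apply: (half (@complex.Re R)) => //; [exact: ReD|exact: Re_le_normc].
by apply: (half (@complex.Im R)) => //; [exact: ImD|exact: Im_le_normc].
Qed.

(** For an absolutely summable family, the sum is identified by any one cofinal
    sequence of finite sets, here the multi-indices of bounded degree. *)
Lemma has_sum_of_ctends v s K : (forall B, \sum_(k <- B) normc (v k) <= K) ->
  ctends (fun M => \sum_(k <- deg_lt M) v k) s -> has_sum v s.
Proof.
move=> vK vs e e0; pose t M := \sum_(k <- deg_lt M) normc (v k).
have ub : has_sup (range t).
  by split; [exists (t 0%N), 0%N | exists K => _ [M _ <-]; exact: vK].
have e2 : 0 < e / 2 by lra.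
have e4 : 0 < e / 4 by lra.
have [_ [M0 _ <-] hM0] := sup_adherent e2 ub.
have [M1 hM1] := vs _ e4.
pose M := maxn M0 M1; exists (deg_lt M) => B MB.
have [N HN] := deg_lt_cofinal B.
have BN : (B `<=` deg_lt (maxn M N))%fset by apply: HN; rewrite leq_maxr.
rewrite (fset_sum_sub _ MB) opprD addrA (le_lt_trans (le_normcB _ _))//.
have h1 : normc (s - \sum_(k <- deg_lt M) v k) <= e / 4.
  by rewrite normc_distC hM1// leq_maxr.
suff h2 : normc (\sum_(k <- B | k \notin deg_lt M) v k) <= e / 2 by lra.
rewrite (le_trans (normc_sum _ _ _))//.
have tM : t M0 <= t M.
  rewrite /t [leRHS](fset_sum_sub _ (deg_lt_sub (leq_maxl M0 M1))) lerDl.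
  by apply: sumr_ge0 => k _; exact: normc_ge0.
have tN : t (maxn M N) <= sup (range t) by apply: ub_le_sup; [exact: ub.2|exists (maxn M N)].
suff : \sum_(k <- B | k \notin deg_lt M) normc (v k) <= t (maxn M N) - t M by lra.
rewrite lerBrDl /t.
rewrite -fset_sum_sub// [leRHS](fset_sum_sub _ BN) lerDl.
by apply: sumr_ge0 => k _; exact: normc_ge0.
Qed.

Lemma monomialZ (y : R[i]) (z : 'rV[R[i]]_n) k :
  monomial (y *: z) k = y ^+ mi_deg k * monomial z k.
Proof.
rewrite /monomial /mi_deg (eq_bigr (fun i => y ^+ k i * z ord0 i ^+ k i)).
  by rewrite big_split /= expr_sum.
by move=> i _; rewrite mxE exprMn.
Qed.

End HasSum.

(** * Radial multipliers and Dirichlet norms *)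

Section Multiplier.
Variables (R : realType) (n : nat).
Local Notation mi := (multi_index n).
Implicit Types (f g : 'rV[R[i]]_n -> R[i]) (a b : mi -> R[i]) (w : nat -> R[i]).
Implicit Type z : 'rV[R[i]]_n.

Definition homogeneous_part a z (m : nat) : R[i] :=
  degree_part (fun k => a k * monomial z k) m.

Lemma homogeneous_partZ a (y : R[i]) z m :
  homogeneous_part a (y *: z) m = homogeneous_part a z m * y ^+ m.
Proof.
rewrite mulrC -degree_partM; congr degree_part.
by apply/funext => k; rewrite monomialZ mulrCA.
Qed.

Lemma homogeneous_part_mult w a z m :
  homogeneous_part (fun k => w (mi_deg k) * a k) z m = w m * homogeneous_part a z m.
Proof.
rewrite -degree_partM; congr degree_part.
by apply/funext => k; rewrite mulrA.
Qed.

Lemma power_series_expands f a z rho :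
  (forall y : R[i], normc y < rho -> unit_ball (y *: z)) ->
  is_power_series f a -> expands (fun y => f (y *: z)) rho (homogeneous_part a z).
Proof.
move=> zrho fa y yr; have := has_sum_ctends (fa _ (zrho y yr)); congr ctends.
apply/funext => M; rewrite deg_lt_sum; apply: eq_bigr => m _.
exact: homogeneous_partZ.
Qed.

(** A factor of subexponential growth is absorbed by comparing the terms at z
    with those at t z for some t > 1; once absolute convergence is known, the sum
    may be computed degree by degree, which is the expansion on the slice. *)
Lemma power_series_multiplier f g a w :
  is_power_series f a ->
  (forall rho : R, 1 < rho -> exists C, forall m, normc (w m) <= C * rho ^+ m) ->
  (forall z, unit_ball z -> exists2 r : R, 1 < r &
    expands (fun y => g (y *: z)) r (fun m => w m * homogeneous_part a z m)) ->
  is_power_series g (fun k => w (mi_deg k) * a k).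
Proof.
move=> fa wgrowth gexp z zb.
have [rho rho1 Hrho] := unit_ball_dilate zb.
pose t := (1 + rho) / 2; have t1 : 1 < t by rewrite /t; lra.
have [C HC] := wgrowth t t1.
have tb : unit_ball (t%:C *: z).
  by apply: Hrho; rewrite normc_real gtr0_norm /t; lra.
have [K HK] := has_sum_abs_bounded (fa _ tb).
have C0 : 0 <= C.
  by have := HC 0%N; rewrite expr0 mulr1; apply: le_trans; exact: normc_ge0.
have [r r1 gz] := gexp z zb.
apply: (@has_sum_of_ctends _ _ _ _ (C * K)) => [B|].
  apply: le_trans (ler_wpM2l C0 (HK B)); rewrite mulr_sumr.
  apply: ler_sum => k _; rewrite monomialZ !normcM normcX normc_real gtr0_norm; last by lra.
  rewrite [leRHS](_ : _ = (C * t ^+ mi_deg k) * (normc (a k) * normc (monomial z k))); last by ring.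
  rewrite [leLHS](_ : _ =
    normc (w (mi_deg k)) * (normc (a k) * normc (monomial z k))); last by ring.
  by rewrite ler_wpM2r ?HC// mulr_ge0 ?normc_ge0.
have := gz 1; rewrite normc_1 scale1r => /(_ r1); congr ctends.
apply/funext => M; rewrite deg_lt_sum; apply: eq_bigr => m _.
by rewrite expr1n mulr1 -homogeneous_part_mult.
Qed.

End Multiplier.

Section Symbol.
Variables (R : realType) (n q : nat).
Hypothesis n0 : (0 < n)%N.

(** The operator of the theorem is a polynomial in the radial derivative; this
    is the factor by which it multiplies homogeneous polynomials of degree m. *)
Definition symbol (m : nat) : nat :=
  (n ^ q + m ^ q + q * \sum_(1 <= i < q) n ^ i * m ^ (q - i))%N.

Lemma symbol_gt0 m : (0 < symbol m)%N.
Proof. by rewrite /symbol -addnA ltn_addr// expn_gt0 n0. Qed.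

Lemma expn_le2r (a b j : nat) : (a <= b)%N -> (a ^ j <= b ^ j)%N.
Proof. by case: j => // j ab; rewrite leq_exp2r. Qed.

Lemma symbol_le m : (symbol m <= (2 + q * q) * (n + m) ^ q)%N.
Proof.
have sq i : (1 <= i < q)%N -> (n ^ i * m ^ (q - i) <= (n + m) ^ q)%N.
  move=> /andP[_ iq]; rewrite -[in leqRHS](subnKC (ltnW iq)) expnD.
  by rewrite leq_mul// expn_le2r// ?leq_addr ?leq_addl.
rewrite mulnDl leq_add//.
  by rewrite mul2n -addnn leq_add ?expn_le2r ?leq_addr ?leq_addl.
rewrite -mulnA leq_mul2l; apply/orP; right.
rewrite (@leq_trans (\sum_(1 <= i < q) (n + m) ^ q))//.
  by rewrite big_nat [leqRHS]big_nat; apply: leq_sum.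
by rewrite sum_nat_const_nat leq_mul2r leq_subr orbT.
Qed.

(** The middle terms of the symbol only help: already n^q + m^q dominates
    max(n, m)^q >= ((n + m) / 2)^q. *)
Lemma symbol_ge m : ((n + m) ^ q <= 2 ^ q * symbol m)%N.
Proof.
have h : ((n + m) ^ q <= 2 ^ q * (maxn n m) ^ q)%N.
  rewrite -expnMn expn_le2r//.
  by rewrite mul2n -addnn leq_add// ?leq_maxl ?leq_maxr.
rewrite (leq_trans h)// leq_mul2l; apply/orP; right.
rewrite /symbol -addnA; case: (leqP n m) => nm.
  by rewrite addnCA leq_addr.
by rewrite leq_addr.
Qed.

(** Bernoulli's inequality for rho = 1 + (rho - 1). *)
Lemma linear_growth (rho : R) : 1 < rho ->
  exists C, forall m, (n + m)%:R <= C * rho ^+ m.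
Proof.
move=> r1; exists (n%:R + (rho - 1)^-1) => m.
have x0 : 0 < rho - 1 by rewrite subr_gt0.
have bern k : 1 + k%:R * (rho - 1) <= rho ^+ k.
  elim: k => [|k IH]; first by rewrite mul0r addr0 expr0.
  rewrite exprS (le_trans _ (ler_wpM2l _ IH)) ?(ltW (lt_trans ltr01 r1))//.
  rewrite -natr1; have := mulr_ge0 (ler0n R k) (sqr_ge0 (rho - 1)).
  by move: (k%:R) => x; lra.
rewrite natrD mulrDl lerD//.
  by rewrite ler_peMr// exprn_ege1// ltW.
rewrite mulrC ler_pdivlMr//; have := bern m; lra.
Qed.

(** Each factor n + m is absorbed by one square root of rho^m. *)
Lemma polynomial_growth j (rho : R) : 1 < rho ->
  exists C, 0 <= C /\ forall m, (n + m)%:R ^+ j <= C * rho ^+ m.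
Proof.
elim: j rho => [|j IH] rho r1.
  by exists 1; split=> // m; rewrite expr0 mul1r exprn_ege1// ltW.
have s1 : 1 < Num.sqrt rho by rewrite -{1}(sqrtr1 R) ltr_sqrt// (lt_trans ltr01).
have [C [C0 HC]] := IH _ s1; have [D HD] := linear_growth s1.
have D0 : 0 <= D by have := HD 0%N; rewrite expr0 mulr1; exact: le_trans.
exists (D * C); split; first exact: mulr_ge0.
move=> m; have -> : rho ^+ m = Num.sqrt rho ^+ m * Num.sqrt rho ^+ m.
  by rewrite -expr2 -exprM mulnC exprM sqr_sqrtr// ltW// (lt_trans ltr01).
by rewrite exprS mulrACA ler_pM// exprn_ge0.
Qed.

Lemma symbol_growth (rho : R) : 1 < rho ->
  exists C, forall m, normc ((symbol m)%:R : R[i]) <= C * rho ^+ m.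
Proof.
move=> r1; have [C [C0 HC]] := polynomial_growth q r1.
exists ((2 + q * q)%:R * C) => m.
rewrite normc_nat -mulrA (le_trans _ (ler_wpM2l _ (HC m)))//.
by rewrite -natrX -natrM ler_nat symbol_le.
Qed.

End Symbol.

Section DirichletNorm.
Variables (R : realType) (n : nat).
Local Notation mi := (multi_index n).

(** The constant is a natural number so that multiplication by it is iterated
    addition of sums. *)
Lemma esum_lty_le (F G : mi -> R) (N : nat) :
  (forall k, 0 <= F k) -> (forall k, 0 <= G k) -> (forall k, F k <= N%:R * G k) ->
  (\esum_(k in [set: mi]) (G k)%:E < +oo)%E ->
  (\esum_(k in [set: mi]) (F k)%:E < +oo)%E.
Proof.
move=> F0 G0 FG Gfin.
apply: (@le_lt_trans _ _ (\esum_(k in [set: mi]) (N%:R * G k)%:E)).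
  by apply: le_esum => k _; rewrite lee_fin.
elim: N {FG} => [|N IH].
  by rewrite esum1 ?ltry// => k _; rewrite mul0r.
under eq_esum do rewrite -natr1 mulrDl mul1r EFinD.
rewrite esumD ?lte_add_pinfty// => k _; rewrite lee_fin ?mulr_ge0//.
Qed.

Lemma dirichlet_sqnorm_le (alpha upsilon : R) (a b : mi -> R[i]) (N : nat) :
  (forall k, (n + mi_deg k)%:R `^ upsilon * normc (b k) ^+ 2 <=
     N%:R * ((n + mi_deg k)%:R `^ alpha * normc (a k) ^+ 2)) ->
  (dirichlet_sqnorm alpha a < +oo)%E -> (dirichlet_sqnorm upsilon b < +oo)%E.
Proof.
move=> H; apply: (@esum_lty_le _ _ N) => k.
- by rewrite !mulr_ge0 ?powR_ge0 ?invr_ge0 ?exprn_ge0 ?normc_ge0.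
- by rewrite !mulr_ge0 ?powR_ge0 ?invr_ge0 ?exprn_ge0 ?normc_ge0.
set W := _ / _; have W0 : 0 <= W by rewrite /W !mulr_ge0 ?invr_ge0.
have {H} := ler_wpM2l W0 (H k); clearbody W.
set x := _ `^ upsilon; set y := _ `^ alpha; clearbody x y.
set u := normc (a k) ^+ 2; set v := normc (b k) ^+ 2; clearbody u v.
have -> : x * W * v = W * (x * v) by ring.
by have -> : N%:R * (y * W * u) = W * (N%:R * (y * u)) by ring.
Qed.

End DirichletNorm.

Theorem proposition1 (R : realType) (n : nat) (f : 'rV[R[i]]_n -> R[i])
    (alpha : R) (q : nat) (upsilon : R) :
  (0 < n)%N ->
  Hol f ->
  alpha = 2 * q%:R + upsilon ->
  Dirichlet alpha f <->
  Dirichlet upsilon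
    (fun z => n%:R ^+ q * f z + iter q (@radial R n) f z
              + q%:R * \sum_(1 <= i < q) n%:R ^+ i * iter (q - i) (@radial R n) f z).
Proof.
move=> n0 hf alphaE; set g := (fun z : 'rV[R[i]]_n => _).
have hg : Hol g.
  apply: HolD; first apply: HolD.
  - exact: HolMl.
  - exact: Hol_iter_radial.
  - by apply/HolMl/Hol_sum => j; apply/HolMl/Hol_iter_radial.
have weight (k : multi_index n) : (n + mi_deg k)%:R `^ alpha =
    ((n + mi_deg k)%:R ^+ q) ^+ 2 * (n + mi_deg k)%:R `^ upsilon :> R.
  have x0 : (n + mi_deg k)%:R != 0 :> R by rewrite pnatr_eq0 addn_eq0 negb_and -lt0n n0.
  rewrite alphaE powRD; last by rewrite x0 implybT.
  by rewrite -natrM powR_mulrn// -exprM mulnC.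
have gexp z : unit_ball z -> exists r c, [/\ 1 < r,
    expands (fun y => f (y *: z)) r c &
    expands (fun y => g (y *: z)) r (fun m => (symbol n q m)%:R * c m)].
  move=> zb; have [r [c [r1 Hc]]] := iter_radial_expansion hf zb.
  have E0 : expands (fun y => f (y *: z)) r c.
    by have := Hc 0%N; congr expands; apply/funext => m; rewrite mul1r.
  exists r, c; split=> //.
  have := expandsD (expandsD (expandsMl (n%:R ^+ q) E0) (Hc q))
    (expandsMl q%:R (expands_sum (index_iota 1 q) (fun j => expandsMl (n%:R ^+ j) (Hc (q - j)%N)))).
  congr expands; apply/funext => m.
  rewrite /symbol !natrD !natrM natr_sum !natrX !mulrDl -mulrA mulr_suml.
  by congr (_ + _ * _); apply: eq_bigr => j _; rewrite natrM !natrX mulrA.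
(* Homogeneous parts are determined by the function, by uniqueness of the
   expansion on each slice. *)
have same_expansion (h : 'rV[R[i]]_n -> R[i]) a z r c :
    is_power_series h a -> unit_ball z -> 1 < r ->
    expands (fun y => h (y *: z)) r c -> homogeneous_part a z = c.
  move=> ha zb r1 hc; have [rho rho1 Hrho] := unit_ball_dilate zb.
  apply/funext; apply: expands_unique (power_series_expands Hrho ha) hc => //; lra.
have sym0 m : (symbol n q m)%:R != 0 :> R[i] by rewrite pnatr_eq0 -lt0n symbol_gt0.
split=> [[_ [a fa na]]|[_ [b gb nb]]]; split=> //.
- exists (fun k => (symbol n q (mi_deg k))%:R * a k).
    apply: (power_series_multiplier (w := fun m => (symbol n q m)%:R) fa) => [rho|z zb].
      exact: symbol_growth.
    have [r [c [r1 fc gc]]] := gexp z zb; exists r => //.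
    by rewrite (same_expansion _ _ _ _ _ fa zb r1 fc).
  apply: (@dirichlet_sqnorm_le _ _ alpha _ a _ ((2 + q * q) ^ 2)%N) na => k.
  rewrite weight normcM normc_nat exprMn.
  rewrite [leLHS](_ : _ = (symbol n q (mi_deg k))%:R ^+ 2 *
    ((n + mi_deg k)%:R `^ upsilon * normc (a k) ^+ 2)); last by ring.
  rewrite [leRHS](_ : _ = ((2 + q * q) ^ 2)%:R * ((n + mi_deg k)%:R ^+ q) ^+ 2 *
    ((n + mi_deg k)%:R `^ upsilon * normc (a k) ^+ 2)); last by ring.
  rewrite ler_wpM2r ?mulr_ge0 ?powR_ge0 ?exprn_ge0 ?normc_ge0//.
  by rewrite -!natrX -natrM ler_nat -expnMn leq_exp2r// symbol_le.
- exists (fun k => (symbol n q (mi_deg k))%:R^-1 * b k).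
    apply: (power_series_multiplier (w := fun m => (symbol n q m)%:R^-1) gb) => [rho rho1|z zb].
      exists 1 => m; rewrite mul1r normcV normc_nat.
      rewrite (@le_trans _ _ 1)//; last by rewrite exprn_ege1// ltW.
      by rewrite invf_le1 ?ler1n ?ltr0n symbol_gt0.
    have [r [c [r1 fc gc]]] := gexp z zb; exists r => //.
    rewrite (same_expansion _ _ _ _ _ gb zb r1 gc).
    by move: fc; congr expands; apply/funext => m; rewrite mulKf.
  apply: (@dirichlet_sqnorm_le _ _ upsilon _ b _ ((2 ^ q) ^ 2)%N) nb => k.
  rewrite weight normcM normcV normc_nat exprMn exprVn.
  set s := (symbol n q (mi_deg k))%:R : R.
  have s0 : 0 < s by rewrite ltr0n symbol_gt0.
  rewrite [leLHS](_ : _ = (((n + mi_deg k)%:R ^+ q) ^+ 2 / s ^+ 2) *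
    ((n + mi_deg k)%:R `^ upsilon * normc (b k) ^+ 2)); last by ring.
  rewrite ler_wpM2r ?mulr_ge0 ?powR_ge0 ?exprn_ge0 ?normc_ge0//.
  rewrite ler_pdivrMr ?exprn_gt0//.
  by rewrite -!natrX -natrM ler_nat -expnMn leq_exp2r// symbol_ge.
Qed.
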